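(* Let $d\ge3$ and consider the annealed Ising model on the random $d$-regular graph with $\beta=\beta_c=\frac12\log\frac{d}{d-2}$ and $B=0$. Then, with $\sigma=(\sigma_1,\dots,\sigma_n)$ distributed according to the annealed measure $\mu_n$, $$\frac{\sigma_1+\dots+\sigma_n}{n^{3/4}}\longrightarrow X\quad\text{in distribution as } n\to\infty,$$ where $X$ is a real random variable with density (with respect to Lebesgue measure) proportional to $$\exp\left(\frac{-(d-1)(d-2)x^4}{12d^2}\right).$$
   Context: Random $d$-regular graph: for $n$ with $dn$ even, take vertices $v_1,\dots,v_n$, each with $d$ incident half-edges, and match the $dn$ half-edges by a uniformly random perfect matching (pairing one arbitrarily selected unmatched half-edge with a uniformly chosen other unmatched half-edge, repeatedly); each matched pair forms an edge. The result is a random multigraph (self-loops and multiple edges allowed). Let $k_{i,j}$ be the number of edges between $v_i$ and $v_j$, and let $\mathbb{E}$ be expectation with respect to the random graph. The limit $n\to\infty$ is along $n$ with $dn$ even. Annealed Ising model: for $\beta\ge 0$, $B\in\mathbb{R}$ and $\sigma\in\Omega_n=\{+1,-1\}^n$, put $H(\sigma)=-\beta\sum_{i\le j}k_{i,j}\sigma_i\sigma_j-B\sum_{i=1}^n\sigma_i$, $Z_n(\beta,B)=\sum_{\sigma\in\Omega_n}e^{-H(\sigma)}$. The annealed measure on $\Omega_n$ is $\mu_n(\sigma)=\mathbb{E}(e^{-H(\sigma)})/\mathbb{E}(Z_n(\beta,B))$. The critical inverse temperature is $\beta_c=\inf\{\beta>0:\lim_{B\searrow0}\mathcal{M}(\beta,B)>0\}$,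 where $\mathcal{M}(\beta,B)=\lim_n\partial_B\frac1n\log\mathbb{E}(Z_n(\beta,B))$; it is known that for $d\ge3$, $\beta_c=\operatorname{atanh}(1/(d-1))=\frac12\log\frac{d}{d-2}$. *)

(* Defs.v *)
From HB Require Import structures.
From mathcomp Require Import all_boot all_order all_algebra.
From mathcomp Require Import all_classical all_reals all_analysis.

Set Implicit Arguments.
Unset Strict Implicit.
Unset Printing Implicit Defensive.

Import Order.TTheory GRing.Theory Num.Theory.
Import numFieldNormedType.Exports.

Local Open Scope classical_set_scope.
Local Open Scope ring_scope.

(* The half-edge (i, a) is the a-th half-edge incident to the vertex i. *)
Definition half_edge (d n : nat) : finType := ('I_n * 'I_d)%type.

Definition perfect_matchings (H : finType) : {set {set {set H}}} :=
  [set M : {set {set H}} |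
    finset.partition M [set: H] & [forall e in M, #|e| == 2%N]]%SET.

(* An edge is a pair of half-edges; it joins i and j when {i, j} is the set of
   vertices its half-edges are incident to. A self-loop at i counts once in
   [num_edges M i i]. *)
Definition num_edges (d n : nat) (M : {set {set half_edge d n}})
    (i j : 'I_n) : nat :=
  #|[set e in M | [set h.1 | h in e] == [set i; j]]%SET|.

(* Pairing the half-edges one after the other yields the uniform law on perfect
   matchings. There is no perfect matching when d * n is odd, and the
   expectation below is then 0. *)
Definition graph_expectation (R : realType) (d n : nat)
    (f : {set {set half_edge d n}} -> R) : R :=
  (\sum_(M in perfect_matchings (half_edge d n)) f M)
    / #|perfect_matchings (half_edge d n)|%:R.

Definition config (n : nat) : finType := {ffun 'I_n -> bool}.

Definition spin (R : realType) (n : nat) (s : config n) (i : 'I_n) : R :=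
  if s i then 1 else -1.

Definition total_spin (R : realType) (n : nat) (s : config n) : R :=
  \sum_(i < n) spin R s i.

Definition hamiltonian (R : realType) (d n : nat) (beta B : R)
    (M : {set {set half_edge d n}}) (s : config n) : R :=
  - beta * (\sum_(i < n) \sum_(j < n | (i <= j)%N)
              (num_edges M i j)%:R * spin R s i * spin R s j)
  - B * \sum_(i < n) spin R s i.

Definition partition_function (R : realType) (d n : nat) (beta B : R)
    (M : {set {set half_edge d n}}) : R :=
  \sum_(s : config n) expR (- hamiltonian beta B M s).

Definition annealed (R : realType) (d n : nat) (beta B : R)
    (s : config n) : R :=
  graph_expectation (fun M : {set {set half_edge d n}} =>
    expR (- hamiltonian beta B M s))
  / graph_expectation (fun M : {set {set half_edge d n}} =>
    partition_function beta B M).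

(* The variables Y n live on the finite spaces T n with probability mass
   functions p n; only the indices n seen by the filter F matter. *)
Definition cvg_in_distribution (R : realType) (F : set_system nat)
    (T : nat -> finType) (p Y : forall n, T n -> R)
    (dS : measure_display) (S : measurableType dS) (P : probability S R)
    (X : {RV P >-> R}) : Prop :=
  forall g : R -> R, continuous g -> (exists K : R, forall x, `|g x| <= K) ->
    (\sum_(t : T n) p n t * g (Y n t))%:E @[n --> F] --> 'E_P[g \o X]%E.

Definition has_density_proportional_to (R : realType)
    (dS : measure_display) (S : measurableType dS) (P : probability S R)
    (X : {RV P >-> R}) (f : R -> R) : Prop :=
  exists2 c : R, 0 < c & forall A : set R, measurable A ->
    distribution P X A = (\int[lebesgue_measure]_(x in A) (c * f x)%:E)%E.

(* Main.v *)
Require Import Defs.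
From HB Require Import structures.
From mathcomp Require Import all_boot all_order all_algebra.
From mathcomp Require Import all_classical all_reals all_analysis.
From mathcomp Require Import measurable_realfun.
From mathcomp Require Import zify ring lra.
Import Order.TTheory GRing.Theory Num.Theory.
Import numFieldNormedType.Exports.

(** A uniform perfect matching enters only through sums, over the pairings of a
    two-coloured set, of products of edge weights that depend on the colours of
    the two ends: [expR beta] for equal colours, [expR (- beta)] for different
    ones. By Wick's formula such a sum is, up to a constant, the moment
    E X^a Y^b of a Gaussian pair of correlation [expR (- 2 beta)], where a and b
    count the two colours. Writing X = U + s V and Y = U - s V with
    (1 - s^2) / (1 + s^2) = exp(- 2 beta) and passing to polar coordinates, the
    radial part depends on a + b only and what is left is the integral of
    x^a y^b over half a turn, x = cos t + s sin t, y = cos t - s sin t. No Gaussian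
    measure is used below: splitting off one edge ([pairing_sum_rec]) and
    integrating by parts along the arc ([arc_moment_rec]) give the same
    recursion, hence [pairing_sum_arc_moment] and [annealed_arc]. The annealed
    measure is therefore a mixture over t of product measures that give the two
    spin values the weights x^d and y^d (signed where y < 0).

    At the critical temperature s^2 = 1 / (d - 1), and this is exactly the value
    for which the quadratic term of [site_factor] = (x^d + y^d) / 2 vanishes: it is
    1 - K t^4 + o(t^4) with K > 0 ([site_factor_quartic]). So the n-th power of
    this factor lives at the scale t ~ n^(-1/4), where it converges to
    the exponential of a negative multiple of the fourth power
    ([site_factor_pow_cvg]). Under the product measure at angle t the mean spin is
    d s t to first order and the total spin fluctuates by n^(1/2), which is
    negligible against n^(3/4); with u = d s t n^(1/4) the rescaled total spin
    is u up to a vanishing error ([tilted_mean_test_cvg]).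

    Dominated convergence in u ([arc_integral_cvg]) concludes. The dominating
    function comes from (|x|^d + |y|^d) / 2 <= exp(- c t^4) on the whole arc
    ([site_factor_abs_le]), a form of the two-point hypercontractive inequality:
    the derivative of [site_factor] is minus a polynomial with nonnegative
    coefficients in cos t and s sin t ([defect_ge]) as long as t, y >= 0, and past that point
    x^2 + y^2 <= 4 / d is enough. The exponent d is written [p.+1] below. *)

Set Implicit Arguments.
Unset Strict Implicit.
Unset Printing Implicit Defensive.

Local Open Scope classical_set_scope.
Local Open Scope ring_scope.

(** * Weighted sums over perfect matchings *)

Section Pairings.
Variable (H : finType).
Implicit Types (D : {set H}) (M : {set {set H}}) (h : H).

Definition pairings D : {set {set {set H}}} :=
  [set M | finset.partition M D & [forall e in M, #|e| == 2%N]]%SET.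

Lemma pairingsP D M : reflect (finset.partition M D /\ forall e, e \in M -> #|e| = 2%N)
  (M \in pairings D).
Proof.
rewrite inE; apply: (iffP andP) => -[pM c2]; split => //.
  by move=> e eM; apply/eqP; move/forall_inP: c2 => /(_ e eM).
by apply/forall_inP => e eM; rewrite c2.
Qed.

Lemma pairings_set0 : pairings finset.set0 = [set finset.set0]%SET.
Proof.
apply/finset.setP => M; rewrite finset.in_set1; apply/pairingsP/eqP => [[]|->].
  by rewrite finset.partition_set0 => /eqP.
by rewrite finset.partition_set0; split => // e; rewrite finset.in_set0.
Qed.

(** Stated as an equivalence on [D :\ h0] so that the sum over the possible
    partners of [h0] collapses to one term. *)
Lemma partner_uniq D M h0 : M \in pairings D -> h0 \in D ->
  exists2 h, h \in (D :\ h0)%SET &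
    forall h', h' \in (D :\ h0)%SET -> ([set h0; h']%SET \in M) = (h' == h).
Proof.
move=> /pairingsP[pM c2] h0D.
have covM := finset.cover_partition pM; have tM := finset.partition_trivIset pM.
have h0c : h0 \in finset.cover M by rewrite covM.
have eM := finset.pblock_mem h0c; have h0e : h0 \in finset.pblock M h0 by rewrite
  finset.mem_pblock.
have /finset.cards1P[h eh] : #|finset.pblock M h0 :\ h0|%SET == 1%N.
  by have := finset.cardsD1 h0 (finset.pblock M h0); rewrite h0e (c2 _ eM) add1n => -[<-].
have pE : finset.pblock M h0 = [set h0; h]%SET by rewrite -(finset.setD1K h0e) eh.
have hh0 : h != h0.
  by have := finset.set11 h; rewrite -eh !inE => /andP[].
exists h.
  rewrite !inE hh0 /=; apply: (fintype.subsetP (finset.partitionS pM eM)).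
  by rewrite pE !inE eqxx orbT.
move=> h'; rewrite !inE => /andP[h'h0 h'D]; apply/idP/eqP => [hM|->]; last by rewrite -pE.
have := finset.def_pblock tM hM (_ : h0 \in _); rewrite !inE eqxx /= => /(_ isT).
rewrite pE => /finset.setP/(_ h'); rewrite !inE eqxx orbT (negbTE h'h0) /=.
by move/eqP.
Qed.

(** Splitting off the edge at a fixed element is what makes the pairing sum
    computable by recursion on the size of the set. *)
Lemma pairing_sum_rec (R : comPzSemiRingType) (w : {set H} -> R) D h0 : h0 \in D ->
  \sum_(M in pairings D) \prod_(e in M) w e =
  \sum_(h in (D :\ h0)%SET) w [set h0; h]%SET *
    \sum_(M in pairings (D :\ h0 :\ h)%SET) \prod_(e in M) w e.
Proof.
move=> h0D.
(* Sort the pairings by the partner of h0. *)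
transitivity (\sum_(M in pairings D) \sum_(h in (D :\ h0)%SET | [set h0; h]%SET \in M)
    \prod_(e in M) w e).
  apply: eq_bigr => M MD; have [h hD hE] := partner_uniq MD h0D.
  rewrite (big_pred1 h) // => h'; rewrite /=.
  have [h'D|h'D] := boolP (h' \in _); first by rewrite hE.
  by apply/esym; apply: contraNF h'D => /eqP ->.
rewrite (exchange_big_dep (fun h => h \in (D :\ h0)%SET)) //=.
apply: eq_bigr => h; rewrite finset.in_setD1 => /andP[hh0 hD]; rewrite big_distrr /=.
have h0h : h0 != h by rewrite eq_sym.
set e0 := [set h0; h]%SET.
have D'E : (D :\ h0 :\ h = D :\: e0)%SET.
  by apply/finset.setP => x; rewrite !inE negb_or andbA [(x != h) && _]andbC.
have e0D : e0 \subset D by apply/fintype.subsetP => x; rewrite !inE => /orP[]/eqP ->.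
rewrite D'E (reindex_onto (fun M => e0 |: M)%SET (fun M => M :\ e0)%SET) /=.
  apply: eq_big => [M|M].
    apply/idP/idP => [/andP[/andP[/pairingsP[pM c2] /andP[_ e0M]] /eqP ME]|/pairingsP[pM c2]].
      apply/pairingsP; rewrite -ME; split; first exact: finset.partitionD1.
      by move=> e; rewrite finset.in_setD1 => /andP[_ /c2].
    have e0nM : e0 \notin M.
      apply/negP => e0M; have := finset.partitionS pM e0M.
      by move=> /fintype.subsetP/(_ h0); rewrite !inE eqxx /= => /(_ isT).
    rewrite finset.setU1K // eqxx finset.setU11 hh0 hD !andbT; apply/pairingsP; split.
      have -> : D = (e0 :|: (D :\: e0))%SET by rewrite -[LHS](finset.setID D e0)
        (finset.setIidPr e0D).
      apply: finset.partitionU1 => //; first by rewrite -card_gt0 cards2.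
      by rewrite finset.disjoints_subset; apply/fintype.subsetP => x; rewrite !inE => ->.
    by move=> e; rewrite finset.in_setU1 => /orP[/eqP ->|/c2//]; rewrite cards2 h0h.
  move=> /andP[_ /eqP ME]; rewrite big_setU1 //=.
  by rewrite -ME !inE eqxx.
by move=> M /and3P[_ _ e0M]; rewrite finset.setD1K.
by move=> M h _ /andP[].
Qed.

(** If the weight of an edge depends only on the colours of its ends, any array
    solving the one-edge recursion computes the pairing sum. *)
Lemma pairing_sum_two_colours (R : comPzRingType) (col : H -> bool) (w : {set H} -> R)
    (wm wb : R) (G : nat -> nat -> nat -> R) :
  (forall h h', h != h' -> w [set h; h']%SET = if col h == col h' then wm else wb) ->
  G 0%N 0%N 0%N = 1 ->
  (forall l a b, (a.+1 + b = l.+1.*2)%N ->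
     G l.+1 a.+1 b = wm * a%:R * G l a.-1 b + wb * b%:R * G l a b.-1) ->
  (forall l a b, (a + b.+1 = l.+1.*2)%N ->
     G l.+1 a b.+1 = wm * b%:R * G l a b.-1 + wb * a%:R * G l a.-1 b) ->
  forall l D, #|D| = l.*2 ->
  \sum_(M in pairings D) \prod_(e in M) w e =
  G l #|[set h in D | col h]%SET| #|[set h in D | ~~ col h]%SET|.
Proof.
move=> wE G0 Ga Gb; elim=> [|l IH] D cD.
  have -> : D = finset.set0 by apply/eqP; rewrite -cards_eq0 cD.
  rewrite pairings_set0 big_set1 big_set0.
  have e0 (P : pred H) : #|[set h in finset.set0 | P h]%SET| = 0%N.
    by apply/eqP; rewrite cards_eq0; apply/eqP/finset.setP => h; rewrite !inE.
  by rewrite (e0 col) (e0 (fun h => ~~ col h)).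
pose pl (D : {set H}) := #|[set h in D | col h]%SET|.
pose mi (D : {set H}) := #|[set h in D | ~~ col h]%SET|.
have plD1 (E : {set H}) h : h \in E -> pl E = (col h + pl (E :\ h)%SET)%N.
  move=> hE; rewrite /pl (finset.cardsD1 h) inE hE /=; congr (_ + _)%N.
  by apply: eq_card => x; rewrite !inE andbA.
have miD1 (E : {set H}) h : h \in E -> mi E = (~~ col h + mi (E :\ h)%SET)%N.
  move=> hE; rewrite /mi (finset.cardsD1 h) inE hE /=; congr (_ + _)%N.
  by apply: eq_card => x; rewrite !inE andbA.
have plmi (E : {set H}) : (pl E + mi E = #|E|)%N.
  rewrite -(finset.cardsID [set h | col h]%SET E); congr (_ + _)%N;
    by apply: eq_card => x; rewrite !inE // andbC.
have /card_gt0P[h0 h0D] : (0 < #|D|)%N by rewrite cD.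
rewrite (pairing_sum_rec _ h0D) -/(pl D) -/(mi D).
set D0 := (D :\ h0)%SET.
have cD0 : #|D0| = l.*2.+1.
  by have := finset.cardsD1 h0 D; rewrite h0D cD doubleS add1n => -[].
transitivity (\sum_(h in D0) (if col h0 == col h then wm else wb) *
    G l (pl D0 - col h)%N (mi D0 - ~~ col h)%N).
  apply: eq_bigr => h hD0; have hh0 : h0 != h.
    by move: hD0; rewrite !inE eq_sym => /andP[].
  rewrite wE // IH; last by have := finset.cardsD1 h D0; rewrite hD0 cD0 add1n => -[].
  rewrite -/(pl _) -/(mi _) (plD1 D0 h) // (miD1 D0 h) //.
  by rewrite !addKn.
have sumE (A B : R) : \sum_(h in D0) (if col h then A else B) = (pl D0)%:R * A + (mi D0)%:R * B.
  rewrite (bigID (fun h => col h)) /= !mulr_natl -!sumr_const; congr (_ + _).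
    apply: congr_big => // [h|h /andP[_ ->]//]; by rewrite inE.
  apply: congr_big => // [h|h /andP[_ /negbTE ->]//]; by rewrite inE.
have := plmi D; rewrite cD (plD1 D h0) // (miD1 D h0) // -/D0 => cE.
case: (boolP (col h0)) cE => ch0 /= cE.
  transitivity (\sum_(h in D0) (if col h then wm * G l (pl D0).-1 (mi D0)
     else wb * G l (pl D0) (mi D0).-1)).
    by apply: eq_bigr => h _; case: (col h) => /=; rewrite ?subn0 ?subn1.
  by rewrite sumE add1n add0n Ga // !mulrA; congr (_ * _ + _ * _); exact: mulrC.
transitivity (\sum_(h in D0) (if col h then wb * G l (pl D0).-1 (mi D0)
     else wm * G l (pl D0) (mi D0).-1)).
  by apply: eq_bigr => h _; case: (col h) => /=; rewrite ?subn0 ?subn1.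
by rewrite sumE add1n add0n Gb // addrC !mulrA; congr (_ * _ + _ * _); exact: mulrC.
Qed.

End Pairings.

(** * The annealed weights as pairing sums *)

Section AnnealedWeight.
Variables (R : realType) (d n : nat) (beta : R).
Implicit Types (s : config n) (M : {set {set half_edge d n}}).

Definition edge_weight s (e : {set half_edge d n}) : R :=
  expR (beta * \prod_(h in e) spin R s h.1).

Lemma edge_weight2 s (h h' : half_edge d n) : h != h' ->
  edge_weight s [set h; h']%SET =
  if s h.1 == s h'.1 then expR beta else expR (- beta).
Proof.
move=> hh'; rewrite /edge_weight big_setU1 ?finset.in_set1 //= big_set1 /spin.
by case: (s h.1); case: (s h'.1) => /=; rewrite ?eqxx ?(mulrN, mulNr, mulr1, opprK).
Qed.

Lemma set2_ord_eq (a b i j : 'I_n) : (a <= b)%N -> (i <= j)%N ->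
  ([set a; b]%SET == [set i; j]%SET) = ((i, j) == (a, b)).
Proof.
move=> ab ij; apply/eqP/eqP => [E|[-> ->]//].
have := finset.set21 a b; have := finset.set22 a b; rewrite E !inE.
have := finset.set21 i j; have := finset.set22 i j; rewrite -E !inE.
do 4 case/orP=> /eqP/(congr1 val)/= ?; congr (_, _); apply/val_inj => /=; lia.
Qed.

(** Of the pairs [i <= j] only the sorted pair of the ends of [e] contributes; for
    a self-loop this is the diagonal pair, of spin product [1]. *)
Lemma edge_spin_product s (e : {set half_edge d n}) : #|e| = 2%N ->
  \sum_(i < n) \sum_(j < n | (i <= j)%N)
     ([set h.1 | h in e]%SET == [set i; j]%SET)%:R * (spin R s i * spin R s j)
  = \prod_(h in e) spin R s h.1.
Proof.
move=> /eqP/cards2P[h [h' [hh' ->]]].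
rewrite big_setU1 ?finset.in_set1 //= big_set1 imsetU1 imset_set1.
wlog le_hh' : h h' hh' / (h.1 <= h'.1)%N.
  move=> W; have /orP[|le] := leq_total h.1 h'.1; first exact: W.
  by rewrite finset.setUC mulrC W // eq_sym.
rewrite pair_big_dep /= (bigD1 (h.1, h'.1)) //= eqxx mul1r big1 ?addr0 //.
move=> [i j] /= /andP[ij /negbTE ne].
by rewrite set2_ord_eq // ne mul0r.
Qed.

Lemma gibbs_weight_prod s M : M \in perfect_matchings (half_edge d n) ->
  expR (- hamiltonian beta 0 M s) = \prod_(e in M) edge_weight s e.
Proof.
move=> /pairingsP[_ c2].
rewrite -expR_sum -mulr_sumr; congr expR.
rewrite /hamiltonian mul0r subr0 mulNr opprK; congr (_ * _).
under [RHS]eq_bigr => e eM do rewrite -(edge_spin_product s (c2 e eM)).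
rewrite exchange_big /=; apply: eq_bigr => i _.
rewrite exchange_big /=; apply: eq_bigr => j _.
rewrite -mulr_suml -mulrA; congr (_ * _).
rewrite /num_edges -sum1_card natr_sum big_mkcond [RHS]big_mkcond /=.
by apply: eq_bigr => e _; rewrite inE; case: (e \in M) => //=; case: eqP.
Qed.

(** The number of pairings cancels. When there is no pairing both sides are
    [0 / 0 = 0]. *)
Lemma annealedE s :
  annealed d beta 0 s =
  (\sum_(M in pairings [set: half_edge d n]%SET) \prod_(e in M) edge_weight s e)
  / \sum_(s' : config n)
     \sum_(M in pairings [set: half_edge d n]%SET) \prod_(e in M) edge_weight s' e.
Proof.
rewrite /annealed /graph_expectation /partition_function.
rewrite exchange_big /=.
have E s' : \sum_(M in perfect_matchings (half_edge d n)) expR (- hamiltonian beta 0 M s') =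
   \sum_(M in pairings [set: half_edge d n]%SET) \prod_(e in M) edge_weight s' e.
  by apply: eq_bigr => M; exact: gibbs_weight_prod.
rewrite E; under [in LHS]eq_bigr do rewrite E.
have [c0|c0] := eqVneq #|perfect_matchings (half_edge d n)| 0%N.
  have P0 : pairings [set: half_edge d n]%SET = finset.set0 by exact: cards0_eq.
  by rewrite P0 big_set0 !mul0r.
by rewrite invf_div mulrA divfK // pnatr_eq0.
Qed.

Lemma card_half_edges s (b : bool) :
  #|[set h in [set: half_edge d n] | s h.1 == b]%SET| = (d * #|[pred i | s i == b]|)%N.
Proof.
rewrite mulnC -[X in (_ * X)%N]card_ord -cardX; apply: eq_card => -[i a].
by rewrite !inE ?andbT.
Qed.

Lemma prod_spin_cases (K : comPzSemiRingType) s (A B : K) :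
  \prod_(i < n) (if s i then A else B) =
  A ^+ #|[pred i | s i == true]| * B ^+ #|[pred i | s i == false]|.
Proof.
rewrite (bigID (fun i => s i)) /= -!prodr_const; congr (_ * _).
  by apply: eq_big => [i|i ->//]; rewrite !inE eqb_id.
by apply: eq_big => [i|i /negbTE ->//]; rewrite !inE eqbF_neg.
Qed.

End AnnealedWeight.

(** * Trigonometric integrals solving the pairing recursion *)

Section EllipseIntegral.
Variable R : realType.
Implicit Types (s t u L : R) (a b l : nat).

(** The point of coordinates [arc_coord s t] and [arc_coord
  (- s) t] describes an ellipse: it is the
    image of the unit circle under (U, V) |-> (U + s V, U - s V). *)
Definition arc_coord s t : R := cos t + s * sin t.
Definition darc_coord s t : R := - sin t + s * cos t.

Lemma arc_coord0 s : arc_coord s 0 = 1. Proof. by rewrite /arc_coord cos0 sin0 mulr0 addr0. Qed.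

Lemma arc_coordN s t : arc_coord s (- t) = arc_coord (- s) t.
Proof. by rewrite /arc_coord cosN sinN mulrN mulNr. Qed.

Lemma is_derive_arc_coord s t : is_derive t 1 (arc_coord s) (darc_coord s t).
Proof.
by rewrite /arc_coord; apply: is_derive_eq.
Qed.

Lemma is_derive_darc_coord s t : is_derive t 1 (darc_coord s) (- arc_coord s t).
Proof.
rewrite /darc_coord; apply: is_derive_eq.
by rewrite /arc_coord /GRing.scale /= mulrN opprD.
Qed.

Lemma continuous_arc_coord s : continuous (arc_coord s).
Proof. by move=> t; apply/differentiable_continuous/derivable1_diffP;
  case: (is_derive_arc_coord s t). Qed.

Lemma darc_coord_sqr s t : darc_coord s t ^+ 2 = 1 + s ^+ 2 - arc_coord s t ^+ 2.
Proof. by have cs := cos2sin2 t; rewrite /arc_coord /darc_coord; ring: cs. Qed.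

Lemma darc_coord_mul s t : darc_coord s t * darc_coord (- s) t = 1 - s ^+ 2 - arc_coord s t
  * arc_coord (- s) t.
Proof. by have cs := cos2sin2 t; rewrite /arc_coord /darc_coord; ring: cs. Qed.

Lemma Rintegral_is_derive (F f : R -> R) (a b : R) : a < b ->
  (forall x : R, is_derive x 1 F (f x)) -> continuous f ->
  (\int[lebesgue_measure]_(x in `[a, b]) f x = F b - F a)%R.
Proof.
move=> ab dF cf; have cF : continuous F.
  by move=> t; apply/differentiable_continuous/derivable1_diffP; case: (dF t).
rewrite /Rintegral (@continuous_FTC2 _ f F) //.
- exact: continuous_subspaceT.
- split=> [x _||].
  + by case: (dF x).
  + exact/cvg_at_right_filter/cF.
  + exact/cvg_at_left_filter/cF.
- by move=> x _; rewrite derive1E; case: (dF x).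
Qed.

Definition moment_fun s L a b u : R := arc_coord s (u / L) ^+ a * arc_coord (- s) (u / L) ^+ b.

(** The moment E X^a Y^b of the Gaussian pair X = U + s V, Y = U - s V in polar
    coordinates, without its radial factor. The angle is [t = u / L]: working with
    [u] from the start avoids a change of variables in the limit. *)
Definition arc_moment s L a b : R :=
  (\int[lebesgue_measure]_(u in `[(- (L * (pi / 2))), (L * (pi / 2))])
     moment_fun s L a b u)%R.

Lemma continuous_moment_fun s L a b : continuous (moment_fun s L a b).
Proof.
move=> u; have cs r : {for u, continuous (fun v : R => arc_coord r (v / L))}.
  apply: (@continuous_comp _ _ _ (fun v : R => v / L) (arc_coord r));
    last exact: continuous_arc_coord.
  by apply: mulrr_continuous.
have cX r k : {for u, continuous (fun v : R => arc_coord r (v / L) ^+ k)}.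
  apply: (@continuous_comp _ _ _ (fun v : R => arc_coord r (v / L)) (fun x : R => x ^+ k)).
    exact: cs.
  exact: exprn_continuous.
by apply: cvgM; exact: cX.
Qed.

Lemma integrable_moment_fun s L a b (A B : R) :
  lebesgue_measure.-integrable `[A, B] (EFin \o moment_fun s L a b).
Proof.
apply: continuous_compact_integrable; first exact: segment_compact.
exact/continuous_subspaceT/continuous_moment_fun.
Qed.

Lemma arc_momentC s L a b : arc_moment (- s) L a b = arc_moment s L b a.
Proof. by apply: eq_Rintegral => u _; rewrite /moment_fun opprK mulrC. Qed.

(** Gaussian integration by parts in polar coordinates: integrate the derivative
    of [x' x^a y^b] along the arc. Its values at the two ends agree because the
    ends are antipodal and [a + 1 + b] is even. *)
Lemma arc_moment_rec s L a b : 0 < L -> ~~ odd (a.+1 + b) ->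
  (a.+1 + b)%:R * arc_moment s L a.+1 b =
  (1 + s ^+ 2) * a%:R * arc_moment s L a.-1 b
  + (1 - s ^+ 2) * b%:R * arc_moment s L a b.-1.
Proof.
move=> L0 ev; have Lpi : 0 < L * (pi / 2) :> R by rewrite mulr_gt0 // divr_gt0 ?pi_gt0.
pose F u := L * (darc_coord s (u / L) * moment_fun s L a b u).
pose f u := - (a.+1 + b)%:R * moment_fun s L a.+1 b u
  + ((1 + s ^+ 2) * a%:R * moment_fun s L a.-1 b u
  + (1 - s ^+ 2) * b%:R * moment_fun s L a b.-1 u).
have dF u : is_derive u 1 F (f u).
  have dl : is_derive u 1 (fun v : R => v / L) (L^-1).
    by apply: is_derive_eq; rewrite /GRing.scale /= ?mulr0 ?add0r ?addr0 mulr1.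
  have dx r : is_derive u 1 (arc_coord r \o (fun v : R => v / L)) (darc_coord r (u / L) * L^-1).
    by apply: is_derive1_comp; exact: is_derive_arc_coord.
  have ddx r : is_derive u 1 (darc_coord r \o (fun v : R => v / L)) (- arc_coord r (u / L)
    * L^-1).
    by apply: is_derive1_comp; exact: is_derive_darc_coord.
  have dX r k : is_derive u 1 (fun v : R => arc_coord r (v / L) ^+ k)
      (k%:R * arc_coord r (u / L) ^+ k.-1 * (darc_coord r (u / L) / L)).
    rewrite (_ : (fun v => _) = (arc_coord r \o (fun v : R => v / L)) ^+ k); last first.
      by apply/funext => v; rewrite exprfctE.
    exact: (is_deriveX k (dx r)).
  have H : is_derive u 1 F _ := is_deriveZ L (is_deriveM (ddx s) (is_deriveM (dX s a) (dX
    (- s) b))).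
  apply: (is_derive_eq H).
  rewrite /f /moment_fun mulrfctE /GRing.scale /=.
  have Li : L * L^-1 = 1 by rewrite divff ?gt_eqF.
  have := darc_coord_sqr s (u / L); have := darc_coord_mul s (u / L).
  move: (arc_coord s _) (arc_coord (- s) _) (darc_coord s _) (darc_coord (- s) _)
    => x y x' y' xy' xx'; move: (L^-1) Li => i Li.
  case: a b {ev F f dl dx ddx H} => [|a] [|b] /=; rewrite ?exprS ?expr0 ?mulr0n;
    [ring: Li xy' xx'| move: (y ^+ b) => yb; ring: Li xy' xx' | move: (x ^+ a) => xa;
      ring: Li xy' xx'|
    move: (y ^+ b) (x ^+ a) => yb xa; ring: Li xy' xx'].
have cf : continuous f.
  by move=> u; apply: cvgD; [|apply: cvgD]; apply: cvgM; try exact: cvg_cst;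
    exact: continuous_moment_fun.
have NLpi : - (L * (pi / 2)) < L * (pi / 2) by rewrite gtrN.
have := Rintegral_is_derive NLpi dF cf.
have -> : F (L * (pi / 2)) - F (- (L * (pi / 2))) = 0.
  rewrite /F /moment_fun mulNr [L * _ / L]mulrAC divff ?gt_eqF // mul1r.
  rewrite /arc_coord /darc_coord cosN sinN cos_pihalf sin_pihalf !mulr0 !mulr1 !add0r.
  rewrite !mulrN1 opprK addr0 opprK.
  suff -> : (- s) ^+ a * s ^+ b = - (s ^+ a * (- s) ^+ b).
    by ring.
  (* a and b have opposite parities. *)
  suff sab : (-1) ^+ b = - (-1) ^+ a :> R.
    by rewrite [(- s) ^+ a]exprNn [(- s) ^+ b]exprNn sab; ring.
  move: ev; rewrite oddD /= -signr_odd -[in RHS]signr_odd.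
  by case: (odd a); case: (odd b); rewrite //= ?expr0 ?expr1 ?opprK.
have iZ k a' b' : lebesgue_measure.-integrable `[- (L * (pi / 2)), L * (pi / 2)]
    (EFin \o (fun u => k * moment_fun s L a' b' u)).
  exact: (integrableZl _ _ (integrable_moment_fun _ _ _ _ _ _)).
rewrite /f RintegralD //; last first.
  exact: (integrableD _ (iZ _ _ _) (iZ _ _ _)).
rewrite RintegralD // !RintegralZl //; try exact: integrable_moment_fun.
by rewrite -/(arc_moment s L _ _) mulNr addrC => /eqP; rewrite subr_eq0 => /eqP ->.
Qed.

End EllipseIntegral.

Section AnnealedArc.
Variables (R : realType).

Lemma arc_moment00_gt0 (s L : R) : 0 < L -> 0 < arc_moment s L 0 0.
Proof.
move=> L0; have Lpi : 0 < L * (pi / 2) :> R by rewrite mulr_gt0 // divr_gt0 ?pi_gt0.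
have NLpi : - (L * (pi / 2)) < L * (pi / 2) by rewrite gtrN.
have dm (u : R) : is_derive u 1 id (moment_fun s L 0 0 u).
  by rewrite /moment_fun !expr0 mulr1; exact: is_derive_id.
have := Rintegral_is_derive NLpi dm (@continuous_moment_fun _ _ _ _ _).
by rewrite -/(arc_moment s L 0 0) => ->; rewrite opprK addr_gt0.
Qed.

(** The pairing sum and the arc moments satisfy the same recursion, so they agree
    up to a constant that does not see the colouring. *)
Lemma pairing_sum_arc_moment (d n : nat) (beta s L : R) : 0 < L -> ~~ odd (d * n) ->
  expR (- beta) * (1 + s ^+ 2) = expR beta * (1 - s ^+ 2) ->
  exists2 c : R, 0 < c & forall sg : config n,
    \sum_(M in pairings [set: half_edge d n]%SET) \prod_(e in M) edge_weight beta sg e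
    = c * arc_moment s L (d * #|[pred i | sg i == true]|) (d * #|[pred i | sg i == false]|).
Proof.
move=> L0 ev bs; have J0 := arc_moment00_gt0 s L0.
have s1 : 0 < 1 + s ^+ 2 by rewrite ltr_pwDl // sqr_ge0.
pose r := expR beta / (1 + s ^+ 2); have r0 : 0 < r by rewrite divr_gt0 ?expR_gt0.
(* r is fixed by the two edge weights; C l collects the factors 2 (j + 1) of
   the left-hand sides of the recursion. *)
pose C l := (arc_moment s L 0 0)^-1 * \prod_(j < l) (r * (j.+1.*2)%:R).
have C0 l : 0 < C l.
  by rewrite mulr_gt0 ?invr_gt0 // prodr_gt0 // => j _; rewrite mulr_gt0 // ltr0n double_gt0.
have CS l : C l.+1 = C l * (r * (l.+1.*2)%:R) by rewrite /C big_ord_recr; exact: mulrA.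
have rm : r * (1 + s ^+ 2) = expR beta by rewrite divfK // gt_eqF.
have rb : r * (1 - s ^+ 2) = expR (- beta).
  by rewrite /r mulrAC -bs mulfK // gt_eqF.
have C00 : C 0%N * arc_moment s L 0 0 = 1.
  by rewrite /C big_ord0 mulr1 mulVf // gt_eqF.
clearbody r C.
have rec l a b : (a.+1 + b)%N = l.+1.*2 ->
    C l.+1 * arc_moment s L a.+1 b = expR beta * a%:R * (C l * arc_moment s L a.-1 b)
      + expR (- beta) * b%:R * (C l * arc_moment s L a b.-1).
  move=> E; have := @arc_moment_rec _ s L a b L0; rewrite E odd_double => /(_ isT) H.
  by rewrite CS -!mulrA H -rm -rb; ring.
have recN l a b : (a + b.+1)%N = l.+1.*2 ->
    C l.+1 * arc_moment s L a b.+1 = expR beta * b%:R * (C l * arc_moment s L a b.-1)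
      + expR (- beta) * a%:R * (C l * arc_moment s L a.-1 b).
  rewrite addnC => E; have := @arc_moment_rec _ (- s) L b a L0.
  rewrite E odd_double sqrrN !arc_momentC => /(_ isT) H.
  by rewrite CS -!mulrA H -rm -rb; ring.
exists (C (d * n)./2) => // sg.
have := @pairing_sum_two_colours _ _ (fun h : half_edge d n => sg h.1) (edge_weight beta sg)
  _ _ (fun l a b => C l * arc_moment s L a b) (edge_weight2 beta sg).
move=> /(_ C00 rec recN (d * n)./2 [set: _]%SET).
rewrite cardsT card_prod !card_ord even_halfK // mulnC => /(_ erefl) ->.
rewrite -!card_half_edges; congr (_ * arc_moment _ _ _ _); apply: eq_card => h; rewrite !inE.
  by rewrite eqb_id.
by rewrite eqbF_neg.
Qed.

(** The annealed measure as a mixture, over the angle, of product measures. The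
    constant of [pairing_sum_arc_moment] cancels. *)
Lemma annealed_arc (d n : nat) (beta s L : R) (sg : config n) : 0 < L -> ~~ odd (d * n) ->
  expR (- beta) * (1 + s ^+ 2) = expR beta * (1 - s ^+ 2) ->
  let w (sg : config n) := (\int[lebesgue_measure]_(u in `[(- (L * (pi / 2))), (L * (pi / 2))])
    \prod_(i < n) (if sg i then arc_coord s (u / L) ^+ d else arc_coord (- s) (u / L) ^+ d))%R in
  annealed d beta 0 sg = w sg / \sum_(sg' : config n) w sg'.
Proof.
move=> L0 ev bs w; have [c c0 cE] := pairing_sum_arc_moment L0 ev bs.
have wE sg' : \sum_(M in pairings [set: half_edge d n]%SET) \prod_(e in M) edge_weight beta sg' e
    = c * w sg'.
  rewrite cE; congr (_ * _); apply: eq_Rintegral => u _.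
  by rewrite prod_spin_cases /moment_fun !exprM.
rewrite annealedE wE; under eq_bigr do rewrite wE.
by rewrite -mulr_sumr -mulf_div divff ?mul1r // gt_eqF.
Qed.

End AnnealedArc.

(** * The polynomial behind criticality *)

Section Defect.
Variable R : realType.
Implicit Types (c z : R) (p : nat).

Definition evn_pow p c z : R := ((c + z) ^+ p + (c - z) ^+ p) / 2.
Definition odd_pow p c z : R := ((c + z) ^+ p - (c - z) ^+ p) / 2.

Lemma evn_powS p c z : evn_pow p.+1 c z = c * evn_pow p c z + z * odd_pow p c z.
Proof. by rewrite /evn_pow /odd_pow !exprS; field. Qed.

Lemma odd_powS p c z : odd_pow p.+1 c z = c * odd_pow p c z + z * evn_pow p c z.
Proof. by rewrite /evn_pow /odd_pow !exprS; field. Qed.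

(** Up to a constant factor, the numerator of the logarithmic derivative of
    ((1 + t)^(p + 1) + (1 - t)^(p + 1)) / (1 + p t^2)^((p + 1) / 2), made
    homogeneous with t = z / c. For c = cos, z = s sin and s^2 = 1 / p this
    quotient is (c + z)^(p + 1) + (c - z)^(p + 1). *)
Definition defect p c z : R := p%:R * z * evn_pow p c z - c * odd_pow p c z.

Lemma defectS p c z : defect p.+1 c z = c * defect p c z + p.+1%:R * z ^+ 2 * odd_pow p c z.
Proof. by rewrite /defect evn_powS odd_powS; ring. Qed.

Lemma defect1 c z : defect 1 c z = 0.
Proof. by rewrite /defect /evn_pow /odd_pow !expr1; field. Qed.

Lemma evn_odd_pow_ge0 p c z : 0 <= c -> 0 <= z -> 0 <= evn_pow p c z /\ 0 <= odd_pow p c z.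
Proof.
move=> c0 z0; elim: p => [|p [IHe IHo]].
  by rewrite /evn_pow /odd_pow !expr0 subrr mul0r; split => //; rewrite divr_ge0.
by rewrite evn_powS odd_powS !addr_ge0 // mulr_ge0.
Qed.

(** The recursion [defectS] produces nonnegative coefficients only, and starts
    with [defect 2 = 2 z ^ 3]: there is no linear term. *)
Lemma defect_ge p c z : 0 <= c -> 0 <= z -> 2 * z ^+ 3 * c ^+ p <= defect p.+2 c z.
Proof.
move=> c0 z0; elim: p => [|p IH].
  by rewrite defectS defect1 expr0 /odd_pow !expr1 le_eqVlt; apply/orP; left; apply/eqP; field.
rewrite defectS [c ^+ _.+1]exprS.
have [_ o0] := evn_odd_pow_ge0 p.+2 c0 z0.
apply: (@le_trans _ _ (c * defect p.+2 c z)).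
  by rewrite mulrCA ler_wpM2l.
by rewrite lerDl mulr_ge0 // mulr_ge0 // sqr_ge0.
Qed.

(** The value of [e] at [0] is the sum of [j (j + 1)] for [j < p], one term for each
    application of [defectS]. *)
Lemma defect_cubic p (c z : R -> R) : continuous c -> continuous z -> c 0 = 1 -> z 0 = 0 ->
  exists e : R -> R, [/\ continuous e,
    e 0 = ((p%:R - 1) * p%:R * (p%:R + 1)) / 3 &
    forall t, defect p (c t) (z t) = z t ^+ 3 * e t].
Proof.
move=> cc cz c0 z0.
suff [b [e [[cb b0 bE] [ce e0 eE]]]] : exists b e : R -> R,
    [/\ continuous b, b 0 = p%:R & forall t, odd_pow p (c t) (z t) = z t * b t] /\
    [/\ continuous e, e 0 = ((p%:R - 1) * p%:R * (p%:R + 1)) / 3 &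
      forall t, defect p (c t) (z t) = z t ^+ 3 * e t] by exists e.
have cM (f g : R -> R) : continuous f -> continuous g -> continuous (fun t => f t * g t).
  by move=> cf cg t; apply: cvgM; [exact: cf|exact: cg].
have cD (f g : R -> R) : continuous f -> continuous g -> continuous (fun t => f t + g t).
  by move=> cf cg t; apply: cvgD; [exact: cf|exact: cg].
have cC (a : R) : continuous (fun _ : R => a) by move=> t; exact: cvg_cst.
have cX (f : R -> R) k : continuous f -> continuous (fun t => f t ^+ k).
  move=> cf t; apply: (@continuous_comp _ _ _ f (fun x : R => x ^+ k)); first exact: cf.
  exact: exprn_continuous.
have cN (f : R -> R) : continuous f -> continuous (fun t => - f t).
  by move=> cf t; apply: cvgN; exact: cf.
elim: p => [|p [b [e [[cb b0 bE] [ce e0 eE]]]]].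
  exists (cst 0), (cst 0); split; split; try exact: cC.
  - by [].
  - by move=> t; rewrite /odd_pow !expr0 subrr mul0r mulr0.
  - by rewrite mulr0 !mul0r.
  - by move=> t; rewrite /defect /odd_pow !expr0 subrr !mul0r !mulr0 subrr.
exists (fun t => c t * b t + evn_pow p (c t) (z t)).
exists (fun t => c t * e t + p.+1%:R * b t); split; split.
- apply: (cD _ _ (cM _ _ cc cb)).
  apply: (cM _ (fun _ => 2^-1)); last exact: cC.
  by apply: (cD); apply: (cX); apply: (cD) => //; exact: cN.
- by rewrite c0 b0 z0 /evn_pow addr0 subr0 expr1n -natr1; field.
- by move=> t; rewrite odd_powS bE; ring.
- by apply: (cD); apply: (cM) => //; exact: cC.
- by rewrite c0 e0 b0 -natr1; field.
- by move=> t; rewrite defectS eE bE; ring.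
Qed.

End Defect.

(** * The single-site factor along the arc *)

Section Monotone.
Variable R : realType.

Lemma le_of_derive_le0 (f df : R -> R) (a b : R) : a <= b ->
  (forall x : R, is_derive x 1 f (df x)) -> (forall x, a <= x <= b -> df x <= 0) -> f b <= f a.
Proof.
move=> ab dF le0; have cf : continuous f.
  by move=> t; apply/differentiable_continuous/derivable1_diffP; case: (dF t).
have [|c /itvP cab E] := @MVT_segment R f df a b ab (fun x _ => dF x).
  exact: continuous_subspaceT.
by rewrite -subr_le0 E mulr_le0_ge0 ?subr_ge0 // le0 // !cab.
Qed.

Lemma cos_decr (t u : R) : 0 <= t -> t <= u -> u <= pi / 2 -> cos u <= cos t.
Proof.
move=> t0 tu up; apply: (@le_of_derive_le0 cos (fun x => - sin x)) => // x /andP[tx xu].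
rewrite oppr_le0 sin_ge0_pi // (le_trans t0 tx) (le_trans xu) // (le_trans up) //.
by rewrite ler_pdivrMr // ler_peMr ?pi_ge0 // ler1n.
Qed.

End Monotone.

Section SiteFactor.
Variables (R : realType) (p : nat) (s : R).
Hypotheses (p2 : (2 <= p)%N) (s0 : 0 < s) (sp : s ^+ 2 * p%:R = 1).
Implicit Types t : R.

Definition site_factor t : R := (arc_coord s t ^+ p.+1 + arc_coord (- s) t ^+ p.+1) / 2.

Let p0 : 0 < p%:R :> R.
Proof. by rewrite ltr0n; case: p p2. Qed.

Lemma site_factorN t : site_factor (- t) = site_factor t.
Proof. by rewrite /site_factor !arc_coordN opprK addrC. Qed.

Lemma site_factor0 : site_factor 0 = 1.
Proof. by rewrite /site_factor !arc_coord0 !expr1n; field. Qed.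

Lemma is_derive_site_factor t :
  is_derive t 1 site_factor (- (p.+1%:R * s * defect p (cos t) (s * sin t))).
Proof.
have dX (r : R) : is_derive t 1 (fun u : R => arc_coord r u ^+ p.+1) (p.+1%:R
  * arc_coord r t ^+ p * darc_coord r t).
  rewrite (_ : (fun u => _) = arc_coord r ^+ p.+1); last by apply/funext => u; rewrite exprfctE.
  exact: (is_deriveX p.+1 (is_derive_arc_coord r t)).
have H : is_derive t 1 site_factor _ := is_deriveM (is_deriveD (dX s) (dX (- s)))
   (is_derive_cst (2^-1 : R) t 1).
apply: (is_derive_eq H); rewrite /GRing.scale /= mulr0 add0r.
rewrite /defect /evn_pow /odd_pow /arc_coord /darc_coord !mulNr.
have : s * (s * p%:R) = 1 by rewrite mulrA -expr2.
move: (cos t) (sin t) (p%:R) => c z P sP.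
move: ((c + s * z) ^+ p) ((c - s * z) ^+ p) => A B.
transitivity (p.+1%:R / 2 * (A * (- (s * (s * P)) * z + s * c) - B * (s * (s * P) * z + s * c))).
  by rewrite sP; field.
by field.
Qed.

Lemma continuous_site_factor : continuous site_factor.
Proof.
move=> t; apply/differentiable_continuous/derivable1_diffP.
by case: (is_derive_site_factor t).
Qed.

(** The derivative of [site_factor] is cubic at the origin by [defect_cubic], which
    gives the quartic term by l'Hopital's rule. It is stated on the right only, as
    [site_factor] is even. *)
Lemma site_factor_quartic :
  (site_factor t - 1) / t ^+ 4 @[t --> (0:R)^'+] -->
  (- ((p%:R - 1) * (p%:R + 1) ^+ 2 / (12 * p%:R)) : R).
Proof.
have sinc : sin t / t @[t --> (0:R)^'+] --> (1 : R).
  apply: (@lhopital_at_right R sin cos id (cst 1) 0 1 1) => //.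
  - by rewrite -[X in _ --> X](@sin0 R); apply: cvg_at_right_filter; exact: continuous_sin.
  - by apply: cvg_at_right_filter; exact: cvg_id.
  - by move=> x _; rewrite oner_neq0.
  - by rewrite -[X in _ --> X](@cos0 R); apply: cvg_at_right_filter;
     under eq_fun do rewrite divr1; exact: continuous_cos.
have cz : continuous (fun t : R => s * sin t).
  by move=> t; apply: cvgM; [exact: cvg_cst|exact: continuous_sin].
have [e [ce e0 eE]] := @defect_cubic R p cos (fun t => s * sin t) (@continuous_cos R) cz
  (@cos0 R) (etrans (congr1 _ (@sin0 R)) (mulr0 s)).
apply: (@lhopital_at_right R (fun t => site_factor t - 1)
  (fun t => - (p.+1%:R * s * defect p (cos t) (s * sin t))) (fun t => t ^+ 4)
  (fun t => 4 * t ^+ 3) 0 1).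
- by [].
- move=> x _; have H := is_deriveB (is_derive_site_factor x) (is_derive_cst (1 : R) x 1).
  by apply: (is_derive_eq H); rewrite subr0.
- move=> x _; rewrite (_ : (fun t : R => t ^+ 4) = id ^+ 4); last by apply/funext => y;
    rewrite exprfctE.
  apply: (is_derive_eq (is_deriveX 4 (is_derive_id x (1:R)))).
  by rewrite /GRing.scale /= mulr1.
- rewrite -[X in _ --> X](subrr (1 : R)); apply: cvgB; last exact: cvg_cst.
  by rewrite -[X in _ --> X]site_factor0; apply: cvg_at_right_filter;
    exact: continuous_site_factor.
- have E4 : 0 ^+ 4 = 0 :> R by rewrite expr0n.
  by rewrite -[X in _ --> X]E4; apply: cvg_at_right_filter; exact: exprn_continuous.
- by move=> x /itvP x0; rewrite mulf_neq0 // expf_neq0 // gt_eqF // x0.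
apply: (@cvg_trans _ ((- (p.+1%:R * s ^+ 4 / 4) * (sin t / t) ^+ 3 * e t) @[t --> (0:R)^'+])).
  apply: near_eq_cvg; near=> t.
  have t0 : t != 0 by rewrite gt_eqF //; near: t; exact: nbhs_right_gt.
  by rewrite eE; field.
have -> : - ((p%:R - 1) * (p%:R + 1) ^+ 2 / (12 * p%:R)) = - (p.+1%:R * s ^+ 4 / 4) * 1 ^+ 3
  * e 0 :> R.
  rewrite e0 expr1n mulr1.
  have -> : s ^+ 4 = p%:R^-1 ^+ 2.
    have -> : s ^+ 4 = (s ^+ 2) ^+ 2 by ring.
    by congr (_ ^+ 2); apply: (mulIf (lt0r_neq0 p0)); rewrite sp mulVf // gt_eqF.
  by rewrite -natr1; field; rewrite gt_eqF.
apply: cvgM; last by apply: cvg_at_right_filter; exact: ce.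
apply: cvgM; first exact: cvg_cst.
by apply: (@continuous_cvg _ _ _ _ _ (fun t => sin t / t) (fun x : R => x ^+ 3)) => //;
  exact: exprn_continuous.
Unshelve. all: by end_near. Qed.

(** The condition on the cosine says that [arc_coord (- s) t] is still nonnegative. There
    the derivative of [site_factor] is at most [- 4 c t ^ 3]. *)
Lemma site_factor_le_near : exists2 c : R, 0 < c &
  forall t, 0 <= t <= pi / 2 -> 1 <= p.+1%:R * cos t ^+ 2 -> site_factor t <= 1 - c * t ^+ 4.
Proof.
(* On the range considered cos >= cos ^ 2 >= dl, and therefore sin y >= dl y. *)
pose dl : R := p.+1%:R^-1; have dl0 : 0 < dl by rewrite invr_gt0.
pose c := p.+1%:R * s ^+ 4 * dl ^+ p.+1 / 2.
have c0 : 0 < c by rewrite !mulr_gt0 ?exprn_gt0 ?invr_gt0.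
exists c => // t /andP[t0 tp] ct.
have cosdl x : 0 <= x -> x <= t -> dl <= cos x.
  move=> x0 xt; apply: (le_trans _ (cos_decr x0 xt tp)).
  have ct0 : 0 <= cos t by rewrite cos_ge0_pihalf // tp andbT (le_trans _ t0)
    // oppr_le0 divr_ge0 ?pi_ge0.
  rewrite /dl -div1r ler_pdivrMr // mulrC (le_trans ct) // ler_wpM2l //.
  by rewrite expr2 ler_piMl // cos_le1.
have sindl x : 0 <= x -> x <= t -> dl * x <= sin x.
  move=> x0 xt.
  have dF (y : R) : is_derive y 1 (fun y => dl * y - sin y) (dl - cos y).
    apply: is_derive_eq; by rewrite /GRing.scale /= mulr1.
  have := @le_of_derive_le0 _ _ _ 0 x x0 dF; rewrite mulr0 sin0 subrr subr_le0; apply.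
  by move=> y /andP[y0 yx]; rewrite subr_le0 cosdl // (le_trans yx).
have dF (y : R) : is_derive y 1 (fun y => site_factor y + c * y ^+ 4)
    (- (p.+1%:R * s * defect p (cos y) (s * sin y)) + c * (4 * y ^+ 3)).
  have d4 : is_derive y 1 (fun y : R => y ^+ 4) (4 * y ^+ 3).
    rewrite (_ : (fun t : R => t ^+ 4) = id ^+ 4); last by apply/funext => z; rewrite exprfctE.
    apply: (is_derive_eq (is_deriveX 4 (is_derive_id y (1:R)))).
    by rewrite /GRing.scale /= mulr1.
  exact: (is_deriveD (is_derive_site_factor y) (is_deriveZ c d4)).
have := @le_of_derive_le0 _ _ _ 0 t t0 dF.
rewrite site_factor0 expr0n mulr0 addr0 -lerBrDr; apply.
move=> y /andP[y0 yt]; rewrite addrC subr_le0.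
have cy := cosdl y y0 yt; have sy := sindl y y0 yt.
have [q pq] : exists q, p = q.+2 by case: p p2 => [|[|q]] //; exists q.
have cy0 := le_trans (ltW dl0) cy.
have sy0 : 0 <= sin y by apply: le_trans sy; rewrite mulr_ge0 // ltW.
have D := @defect_ge R q (cos y) (s * sin y) cy0 (mulr_ge0 (ltW s0) sy0).
rewrite -pq in D.
rewrite (_ : c * (4 * y ^+ 3) = p.+1%:R * (s * (2 * (s * (dl * y)) ^+ 3 * dl ^+ q))); last first.
  by rewrite /c pq !exprS expr0; field.
rewrite -[leRHS]mulrA ler_wpM2l // ler_wpM2l ?(ltW s0) //; apply: le_trans D.
have dly : 0 <= s * (dl * y) by rewrite !mulr_ge0 // ltW.
have dlsy : (s * (dl * y)) ^+ 3 <= (s * sin y) ^+ 3.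
  by apply: lerXn2r; [rewrite nnegrE|rewrite nnegrE mulr_ge0 // ltW|rewrite ler_wpM2l // ltW].
have dlcy : dl ^+ q <= cos y ^+ q by apply: lerXn2r; rewrite ?nnegrE ?(ltW dl0).
by apply: ler_pM => //; [rewrite mulr_ge0 // exprn_ge0|rewrite exprn_ge0
  // ltW|rewrite ler_wpM2l].
Qed.

(** Past the sign change x^2 + y^2 <= 4 / (p + 1). For [p >= 3] this is at most [1]
    and bounds the higher powers; for [p = 2] the Cauchy-Schwarz inequality gives
    x^3 + y^3 <= (4 / 3)^(3 / 2) < 8 / 5. *)
Lemma site_factor_abs_far t : p.+1%:R * cos t ^+ 2 <= 1 ->
  (`|arc_coord s t| ^+ p.+1 + `|arc_coord (- s) t| ^+ p.+1) / 2 <= 4 / 5.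
Proof.
move=> ct.
have sq : `|arc_coord s t| ^+ 2 + `|arc_coord (- s) t| ^+ 2 = 2 * cos t ^+ 2 + 2 * (s ^+ 2
  * sin t ^+ 2).
  by rewrite !real_normK ?num_real // /arc_coord; ring.
have sqle : p.+1%:R * (`|arc_coord s t| ^+ 2 + `|arc_coord (- s) t| ^+ 2) <= 4.
  have cs := cos2Dsin2 t; rewrite sq -(ler_pM2l p0).
  have -> : p%:R * (p.+1%:R * (2 * cos t ^+ 2 + 2 * (s ^+ 2 * sin t ^+ 2))) =
    p.+1%:R * (2 * p%:R * cos t ^+ 2 + 2 * (s ^+ 2 * p%:R) * sin t ^+ 2) by ring.
  rewrite sp; have -> : sin t ^+ 2 = 1 - cos t ^+ 2 by rewrite -cs; ring.
  move: ct; rewrite -!natr1; have : 2 <= p%:R :> R by rewrite ler_nat.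
  move: (cos t ^+ 2) (p%:R) => C P P2 ct.
  have : 2 * (P - 1) * ((P + 1) * C) <= 2 * (P - 1) * 1 by apply: ler_wpM2l => //; lra.
  lra.
move: sqle (normr_ge0 (arc_coord s t)) (normr_ge0 (arc_coord (- s) t)).
move: `|arc_coord s t| `|arc_coord (- s) t| => X Y XY X0 Y0.
case: (ltngtP p 2) p2 => // [p3 _|p_eq _].
  have XY1 : X ^+ 2 + Y ^+ 2 <= 1.
    rewrite -(@ler_pM2l _ 4) // mulr1; apply: le_trans XY.
    by rewrite ler_wpM2r ?addr_ge0 ?sqr_ge0 // ler_nat.
  have pow (Z : R) : 0 <= Z -> Z ^+ 2 <= 1 -> Z ^+ p.+1 <= Z ^+ 2.
    move=> Z0 Z1; apply: ler_wiXn2l => //; last by rewrite ltnS ltnW.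
    by rewrite -(@expr_le1 _ 2).
  have X1 := pow X X0 (le_trans (_ : X ^+ 2 <= X ^+ 2 + Y ^+ 2) XY1).
  have Y1 := pow Y Y0 (le_trans (_ : Y ^+ 2 <= X ^+ 2 + Y ^+ 2) XY1).
  have {}X1 := X1 ltac:(by rewrite lerDl sqr_ge0).
  have {}Y1 := Y1 ltac:(by rewrite lerDr sqr_ge0).
  lra.
rewrite {}p_eq in XY *.
have cauchy : (X ^+ 3 + Y ^+ 3) ^+ 2 <= (X ^+ 2 + Y ^+ 2) ^+ 3.
  have X2 := sqr_ge0 X; have Y2 := sqr_ge0 Y; have := mulr_ge0 X2 Y2; have XY0 := mulr_ge0 X0 Y0.
  have D : (X ^+ 2 + Y ^+ 2) ^+ 3 - (X ^+ 3 + Y ^+ 3) ^+ 2 =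
    X ^+ 2 * Y ^+ 2 * (3 * X ^+ 2 + 3 * Y ^+ 2 - 2 * (X * Y)) by ring.
  move=> XY2; rewrite -subr_ge0 D mulr_ge0 //.
  have := sqr_ge0 (X - Y); rewrite sqrrB; lra.
have S43 : X ^+ 2 + Y ^+ 2 <= 4 / 3 by move: XY; lra.
have : (X ^+ 3 + Y ^+ 3) ^+ 2 <= (8 / 5) ^+ 2.
  apply: (le_trans cauchy); apply: (@le_trans _ _ ((4 / 3) ^+ 3)); last by lra.
  by apply: lerXn2r; rewrite ?nnegrE ?addr_ge0 ?sqr_ge0.
rewrite ler_sqr ?nnegrE ?addr_ge0 ?exprn_ge0 //; lra.
Qed.

(** The bound that dominates the integrand: up to the angle where the second
    factor changes sign it comes from the monotonicity of [site_factor], beyond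
    it from comparing norms on the ellipse. *)
Lemma site_factor_abs_le : exists2 c : R, 0 < c &
  forall t, `|t| <= pi / 2 ->
  (`|arc_coord s t| ^+ p.+1 + `|arc_coord (- s) t| ^+ p.+1) / 2 <= expR (- (c * t ^+ 4)).
Proof.
have [c1 c10 near] := site_factor_le_near.
(* As t < 2, a constant at most 1 / 80 ensures 1 - c t ^ 4 >= 4 / 5. *)
exists (Num.min c1 80^-1); first by rewrite lt_min c10 invr_gt0 ltr0n.
set c := Num.min _ _; have cc1 : c <= c1 by rewrite ge_min lexx.
have c80 : c <= 80^-1 by rewrite ge_min lexx orbT.
have expge t : 1 - c * t ^+ 4 <= expR (- (c * t ^+ 4)) by exact: expR_ge1Dx.
move=> t; wlog t0 : t / 0 <= t => [W|].
  have [/W//|t0] := leP 0 t; move=> tp.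
  have := W (- t); rewrite oppr_ge0 normrN !arc_coordN opprK => /(_ (ltW t0) tp).
  have -> : (- t) ^+ 4 = t ^+ 4 by ring.
  by rewrite [X in X / 2]addrC.
rewrite ger0_norm // => tp; have tp' : 0 <= t <= pi / 2 by rewrite t0.
apply: (le_trans _ (expge t)).
have t4 : 0 <= t ^+ 4 by rewrite exprn_ge0.
have [ct|ct] := leP 1 (p.+1%:R * cos t ^+ 2).
  have c0 : 0 <= cos t by rewrite cos_ge0_pihalf // tp andbT (le_trans _ t0)
    // oppr_le0 divr_ge0 ?pi_ge0.
  have si0 : 0 <= sin t.
    by rewrite sin_ge0_pi // t0 (le_trans tp) // ler_pdivrMr // ler_peMr ?pi_ge0 // ler1n.
  have y0 : 0 <= arc_coord (- s) t.
    rewrite /arc_coord mulNr subr_ge0 -(@ler_sqr _ (s * sin t)) ?nnegrE ?mulr_ge0 ?(ltW s0) //.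
    rewrite exprMn -(ler_pM2l p0) mulrA [_ * s ^+ 2]mulrC sp mul1r.
    have cs := cos2Dsin2 t; rewrite -natr1 in ct; lra.
  have x0 : 0 <= arc_coord s t by rewrite /arc_coord addr_ge0 // mulr_ge0 // ltW.
  rewrite !ger0_norm //; apply: (le_trans (near t tp' ct)).
  by rewrite lerB // ler_wpM2r.
apply: (le_trans (site_factor_abs_far (ltW ct))).
have t16 : t ^+ 4 <= 2 ^+ 4.
  by apply: lerXn2r; rewrite ?nnegrE // (le_trans tp) // ltW // pihalf_lt2.
have : c * t ^+ 4 <= 80^-1 * 2 ^+ 4 by apply: ler_pM => //; rewrite /c le_min
  (ltW c10) invr_ge0 ler0n.
lra.
Qed.

End SiteFactor.

(** * Concentration of the total spin under a product measure *)

Section ProductMeasure.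
Variable R : realType.

Lemma sum_config_prod (n : nat) (F : 'I_n -> bool -> R) :
  \sum_(sg : config n) \prod_(i < n) F i (sg i) = \prod_(i < n) (F i true + F i false).
Proof.
rewrite -bigA_distr_bigA; apply: eq_bigr => i _.
by rewrite big_bool.
Qed.

(** The terms [a (sg i) * a (sg j)] with [i != j] vanish because [a] is centred under
    [v]. *)
Lemma product_second_moment (n : nat) (v a : bool -> R) :
  v true + v false = 1 -> v true * a true + v false * a false = 0 ->
  \sum_(sg : config n) (\prod_(i < n) v (sg i)) * (\sum_(i < n) a (sg i)) ^+ 2
  = n%:R * (v true * a true ^+ 2 + v false * a false ^+ 2).
Proof.
move=> v1 a0; pose t (i k : 'I_n) (b : bool) := if k == i then a b else 1.
(* t i k puts the factor a on the coordinate i only, so that each term of the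
   expanded square is a product over the coordinates. *)
transitivity (\sum_(i < n) \sum_(j < n) \sum_(sg : config n)
    \prod_(k < n) (v (sg k) * (t i k (sg k) * t j k (sg k)))).
  under [RHS]eq_bigr do rewrite exchange_big; rewrite [RHS]exchange_big /=.
  apply: eq_bigr => sg _; rewrite expr2 mulr_suml mulr_sumr; apply: eq_bigr => i _.
  rewrite mulr_sumr mulr_sumr; apply: eq_bigr => j _.
  have tE l : \prod_(k < n) t l k (sg k) = a (sg l).
    by rewrite (bigD1 l) //= {1}/t eqxx big1 ?mulr1 // => k /negbTE kl; rewrite /t kl.
  by rewrite !big_split /= !tE.
rewrite mulr_natl -[n in RHS]card_ord -sumr_const; apply: eq_bigr => i _.
rewrite (bigD1 i) //= [X in _ + X]big1 ?addr0 => [|j ji].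
  rewrite (sum_config_prod (fun k b => v b * (t i k b * t i k b))).
  rewrite (bigD1 i) //= {1 2 3 4}/t eqxx -!expr2 big1 ?mulr1 // => k /negbTE ki.
  by rewrite /t ki !mulr1.
rewrite (sum_config_prod (fun k b => v b * (t i k b * t j k b))).
by rewrite (bigD1 i) //= {1 2 3 4}/t eqxx eq_sym (negbTE ji) !mulr1 a0 mul0r.
Qed.

(** With [r = n^(1/4)]: the total spin has mean [n (v true - v false)] and a variance of at
    most [n], so that divided by [r ^ 3] it is [r (v true - v false)] up to an error
    of variance [1 / r ^ 2]. *)
Lemma product_spin_second_moment (n : nat) (v : bool -> R) (r u : R) : 0 < r -> n%:R = r ^+ 4 ->
  v true + v false = 1 -> 0 <= v true -> 0 <= v false ->
  \sum_(sg : config n) (\prod_(i < n) v (sg i)) * (total_spin R sg / r ^+ 3 - u) ^+ 2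
  <= 2 / r ^+ 2 + 2 * (r * (v true - v false) - u) ^+ 2.
Proof.
move=> r0 nr v1 vt vf; set m := v true - v false.
pose a (b : bool) : R := (if b then 1 else -1) - m.
have a0 : v true * a true + v false * a false = 0.
  rewrite /a /m; have -> : v false = 1 - v true by rewrite -v1; ring.
  by ring.
have SM := product_second_moment n v1 a0.
have P1 : \sum_(sg : config n) \prod_(i < n) v (sg i) = 1.
  by rewrite (sum_config_prod (fun _ b => v b)) big1.
have tE (sg : config n) : total_spin R sg / r ^+ 3 - u = (\sum_(i < n) a (sg i)) / r ^+ 3 + (r
  * m - u).
  rewrite /a sumrB sumr_const card_ord -mulr_natl nr /total_spin /spin.
  by field; rewrite gt_eqF.
(* (A + B) ^ 2 <= 2 A ^ 2 + 2 B ^ 2 spares the cross term. *)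
apply: (@le_trans _ _ (\sum_(sg : config n) (\prod_(i < n) v (sg i)) *
   (2 / r ^+ 6 * (\sum_(i < n) a (sg i)) ^+ 2 + 2 * (r * m - u) ^+ 2))).
  apply: ler_sum => sg _; rewrite ler_wpM2l //.
    by apply: prodr_ge0 => i _; case: (sg i).
  rewrite tE; move: (\sum_(i < n) _) (r * m - u) => A B.
  have -> : 2 / r ^+ 6 * A ^+ 2 = 2 * (A / r ^+ 3) ^+ 2 by field; rewrite gt_eqF.
  by move: (A / r ^+ 3) => D; have := sqr_ge0 (D - B); rewrite sqrrB sqrrD; lra.
under eq_bigr do rewrite mulrDr mulrCA.
rewrite big_split /= -mulr_sumr -mulr_suml P1 SM mul1r lerD2r nr.
have -> : 2 / r ^+ 6 * (r ^+ 4 * (v true * a true ^+ 2 + v false * a false ^+ 2)) =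
  2 / r ^+ 2 * (v true * a true ^+ 2 + v false * a false ^+ 2) by field; rewrite gt_eqF.
rewrite ler_piMr ?divr_ge0 ?sqr_ge0 //.
have -> : v true * a true ^+ 2 + v false * a false ^+ 2 = 1 - m ^+ 2.
  rewrite /a /m; have -> : v false = 1 - v true by rewrite -v1; ring.
  by ring.
by rewrite gerBl sqr_ge0.
Qed.

(** Turns a bound on second moments into a bound on the mean of a test function,
    without passing through tail probabilities. *)
Lemma continuous_bounded_quadratic (g : R -> R) (u K e : R) : continuous g ->
  (forall x, `|g x| <= K) -> 0 < e ->
  exists2 C : R, 0 <= C & forall y, `|g y - g u| <= e + C * (y - u) ^+ 2.
Proof.
move=> cg gK e0; have /cvgrPdist_lt/(_ e e0) := cg u.
move=> /nbhs_ballP[dl /= dl0 H].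
have K0 : 0 <= K := le_trans (normr_ge0 _) (gK u).
have C0 : 0 <= 2 * K / dl ^+ 2 by rewrite divr_ge0 ?sqr_ge0 // mulr_ge0.
exists (2 * K / dl ^+ 2) => // y.
have [yu|yu] := ltP `|u - y| dl.
  have lte : `|g y - g u| <= e by rewrite distrC ltW //; apply: H.
  by rewrite (le_trans lte) // lerDl mulr_ge0 ?sqr_ge0.
apply: (@le_trans _ _ (2 * K)).
  by rewrite (le_trans (ler_normB _ _)) // mulr_natl mulr2n lerD.
apply: (@le_trans _ _ (2 * K / dl ^+ 2 * (y - u) ^+ 2)); last by rewrite lerDr ltW.
rewrite mulrAC ler_pdivlMr ?exprn_gt0 // ler_wpM2l ?mulr_ge0 //.
rewrite -[leRHS]real_normK ?num_real // distrC.
by apply: lerXn2r => //; rewrite nnegrE ltW.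
Qed.

End ProductMeasure.

(** * The rescaled integrand *)

Section PowerLimit.
Variable R : realType.

(** Squeezed between [expR (n b / (1 + b))] and [expR (n b)]. *)
Lemma exp_pow_limit (b : nat -> R) (l : R) :
  n%:R * b n @[n --> \oo] --> l -> (1 + b n) ^+ n @[n --> \oo] --> expR l.
Proof.
move=> nbl.
have b0 : b n @[n --> \oo] --> (0 : R).
  have H : n%:R^-1 * (n%:R * b n) @[n --> \oo] --> (0 * l : R).
    apply: cvgM => //; apply/gtr0_cvgV0; last exact: cvgr_idn.
    by near=> n; rewrite ltr0n; near: n; exact: nbhs_infty_gt.
  rewrite mul0r in H; apply: cvg_trans H; apply: near_eq_cvg; near=> n.
  by rewrite mulKf // pnatr_eq0 -lt0n; near: n; exact: nbhs_infty_gt.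
have b1 : 1 + b n @[n --> \oo] --> (1 : R).
  by rewrite -[X in _ --> X]addr0; apply: cvgD => //; exact: cvg_cst.
have lo : n%:R * b n / (1 + b n) @[n --> \oo] --> l.
  rewrite -[X in _ --> X]divr1; apply: cvgM => //; apply: cvgV; last exact: b1.
  by rewrite oner_neq0.
apply: (squeeze_cvgr (f := fun n => expR (n%:R * b n / (1 + b n))) (h := fun n => expR (n%:R
  * b n))).
- near=> n; have p : 0 < 1 + b n by near: n; apply: cvgr_gt b1 _ _; exact: ltr01.
  rewrite -mulrA !expRM_natl; apply/andP; split.
    apply: lerXn2r; rewrite ?nnegrE ?expR_ge0 ?(ltW p) //.
    rewrite -[leRHS]invrK -[leLHS]invrK lef_pV2 ?posrE ?invr_gt0 ?expR_gt0 // -expRN.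
    apply: le_trans (expR_ge1Dx _); rewrite le_eqVlt; apply/orP; left; apply/eqP.
    by field; rewrite gt_eqF.
  by apply: lerXn2r; rewrite ?nnegrE ?expR_ge0 ?(ltW p) // expR_ge1Dx.
- by apply: continuous_cvg => //; exact: continuous_expR.
- by apply: continuous_cvg => //; exact: continuous_expR.
Unshelve. all: by end_near. Qed.

End PowerLimit.

Section QuarterPower.
Variable R : realType.

Lemma powR14_4 (n : nat) : (n%:R `^ (1 / 4)) ^+ 4 = n%:R :> R.
Proof.
case: n => [|n]; first by rewrite powR0 ?expr0n //; lra.
by rewrite -powR_mulrn ?powR_ge0 // -powRrM div1r mulVf // powRr1.
Qed.

Lemma powR34 (n : nat) : n%:R `^ (3 / 4) = (n%:R `^ (1 / 4)) ^+ 3 :> R.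
Proof.
by rewrite -powR_mulrn ?powR_ge0 // -powRrM; congr (_ `^ _); field.
Qed.

Lemma powR14_gt0 (n : nat) : (0 < n)%N -> 0 < n%:R `^ (1 / 4) :> R.
Proof. by move=> n0; rewrite powR_gt0 // ltr0n. Qed.

Lemma powR14_cvgy : n%:R `^ (1 / 4) @[n --> \oo] --> (+oo : set_system R).
Proof.
apply/cvgryPge => A; near=> n.
rewrite (le_trans (ler_norm A)) // -(@ler_pXn2r _ 4) ?nnegrE ?powR_ge0 // powR14_4.
by near: n; exact: nbhs_infty_ger.
Unshelve. all: by end_near. Qed.

End QuarterPower.

Section Integrand.
Variables (R : realType) (p : nat) (s : R).
Hypotheses (p2 : (2 <= p)%N) (s0 : 0 < s) (sp : s ^+ 2 * p%:R = 1).

(** Chosen so that the product measure at angle [u / arc_scale n] has mean spin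
    [u / n^(1/4)] to first order ([tilted_mean_cvg]): the rescaled total spin is then
    close to [u]. *)
Definition arc_scale (n : nat) : R := p.+1%:R * s * n%:R `^ (1 / 4).

Definition tilted_sum (g : R -> R) (n : nat) (t : R) : R :=
  \sum_(sg : config n) (\prod_(i < n) (if sg i then arc_coord s t ^+ p.+1 else arc_coord
    (- s) t ^+ p.+1)) *
     g (total_spin R sg / n%:R `^ (3 / 4)).

(** The indicator puts all the arcs on the same domain of integration, and the power
    of [2] makes the single-site weights average to [site_factor]. *)
Definition arc_integrand (g : R -> R) (n : nat) (u : R) : R :=
  \1_(`[(- (arc_scale n * (pi / 2))), (arc_scale n * (pi / 2))]%classic) u
  * (tilted_sum g n (u / arc_scale n) / 2 ^+ n).

Lemma arc_scale_gt0 (n : nat) : (0 < n)%N -> 0 < arc_scale n.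
Proof. by move=> n0; rewrite !mulr_gt0 ?powR14_gt0. Qed.

Lemma tilted_sum_le (g : R -> R) (K : R) n t : (forall x, `|g x| <= K) ->
  `|tilted_sum g n t| <= (`|arc_coord s t| ^+ p.+1 + `|arc_coord (- s) t| ^+ p.+1) ^+ n * K.
Proof.
move=> gK; apply: (le_trans (ler_norm_sum _ _ _)).
have E := sum_config_prod (fun (i : 'I_n) b => if b then `|arc_coord s t| ^+ p.+1 else
  `|arc_coord (- s) t| ^+ p.+1).
rewrite prodr_const card_ord /= in E; rewrite -E mulr_suml; apply: ler_sum => sg _.
rewrite normrM normr_prod ler_pM ?prodr_ge0 //.
by apply: ler_prod => i _; rewrite normr_ge0 /=; case: (sg i); rewrite normrX.
Qed.

Lemma arc_integrand_le (g : R -> R) (K : R) : (forall x, `|g x| <= K) ->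
  exists2 c : R, 0 < c & forall n u, `|arc_integrand g n u| <= K * expR (- (c * u ^+ 4)).
Proof.
move=> gK; have K0 : 0 <= K := le_trans (normr_ge0 _) (gK 0).
have [c c0 bd] := site_factor_abs_le p2 s0 sp.
have ds0 : 0 < p.+1%:R * s by rewrite mulr_gt0.
exists (c / (p.+1%:R * s) ^+ 4); first by rewrite divr_gt0 ?exprn_gt0.
move=> n u; rewrite /arc_integrand indicE.
case: (boolP (u \in _)) => [|_]; last by rewrite mul0r normr0 mulr_ge0 ?expR_ge0.
rewrite inE /= in_itv /= mul1r => uL.
rewrite normrM normfV [`|2 ^+ n|]ger0_norm ?exprn_ge0 // ler_pdivrMr ?exprn_gt0 //.
apply: (le_trans (tilted_sum_le _ _ gK)).
rewrite [leLHS]mulrC -[leRHS]mulrA ler_wpM2l // -ler_pdivrMr ?exprn_gt0 // -expr_div_n.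
(* For n = 0 the arc is reduced to the point 0. *)
case: n uL => [|n] uL.
  move: uL; rewrite /arc_scale powR0 ?mulr0 ?mul0r ?oppr0; last by lra.
  by rewrite -eq_le => /eqP <-; rewrite expr0n !mulr0 oppr0 expR0 expr0.
have L0 := arc_scale_gt0 (ltn0Sn n).
have -> : - (c / (p.+1%:R * s) ^+ 4 * u ^+ 4) = n.+1%:R * - (c * (u / arc_scale n.+1) ^+ 4).
  rewrite expr_div_n /arc_scale [(_ * s * _) ^+ 4]exprMn powR14_4.
  by field; rewrite !nat1r !pnatr_eq0 (gt_eqF s0).
rewrite expRM_natl; apply: lerXn2r; rewrite ?nnegrE ?expR_ge0 ?divr_ge0 ?addr_ge0 //.
apply: bd; rewrite normrM normfV (gtr0_norm L0) ler_pdivrMr // mulrC ler_norml.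
by move: uL => /andP[-> ->].
Qed.

Lemma continuous_tilted_sum (g : R -> R) n (L : R) : continuous (fun u : R => tilted_sum g n (u
  / L)).
Proof.
rewrite (_ : (fun u => _) = fun u => \sum_(sg : config n) moment_fun s L
    (p.+1 * #|[pred i | sg i == true]|) (p.+1 * #|[pred i | sg i == false]|) u
    * g (total_spin R sg / n%:R `^ (3 / 4))); last first.
  by apply/funext => u; apply: eq_bigr => sg _; rewrite prod_spin_cases /moment_fun !exprM.
apply: continuous_big => [|sg _ u]; first exact: add_continuous.
apply: cvgM; last exact: cvg_cst.
exact: continuous_moment_fun.
Qed.

Lemma measurable_arc_integrand (g : R -> R) n : measurable_fun setT (arc_integrand g n).
Proof.
apply: measurable_funM => //.
apply: measurable_funM => //; apply: continuous_measurable_fun.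
exact: continuous_tilted_sum.
Qed.

Lemma integral_arc_integrand (g : R -> R) n :
  (\int[lebesgue_measure]_u (arc_integrand g n u)%:E)%E =
  ((\sum_(sg : config n)
    (\int[lebesgue_measure]_(u in `[(- (arc_scale n * (pi / 2))), (arc_scale n * (pi / 2))])
     \prod_(i < n) (if sg i then arc_coord s (u / arc_scale n) ^+ p.+1
                    else arc_coord (- s) (u / arc_scale n) ^+ p.+1))%R *
    g (total_spin R sg / n%:R `^ (3 / 4))) / 2 ^+ n)%:E.
Proof.
set D := `[_, _]%classic.
transitivity ((\int[lebesgue_measure]_(u in D) (tilted_sum g n (u / arc_scale n) / 2 ^+ n)%:E)%E).
  rewrite [RHS]integral_mkcond; apply: eq_integral => u _.
  rewrite /arc_integrand patchE indicE -/D; case: (u \in D); by rewrite ?mul1r ?mul0r.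
pose P (sg : config n) (u : R) := \prod_(i < n) (if sg i then arc_coord s (u
  / arc_scale n) ^+ p.+1
                    else arc_coord (- s) (u / arc_scale n) ^+ p.+1).
have iM sg : lebesgue_measure.-integrable D (EFin \o P sg).
  rewrite (_ : P sg = moment_fun s (arc_scale n)
    (p.+1 * #|[pred i | sg i == true]|) (p.+1 * #|[pred i | sg i == false]|)).
    exact: integrable_moment_fun.
  by apply/funext => u; rewrite /P prod_spin_cases /moment_fun !exprM.
pose c (sg : config n) := g (total_spin R sg / n%:R `^ (3 / 4)) / 2 ^+ n.
transitivity (\int[lebesgue_measure]_(u in D) (\sum_(sg : config n) ((P sg u)%:E * (c sg)%:E)))%E.
  apply: eq_integral => u _; rewrite /tilted_sum mulr_suml -sumEFin; apply: eq_bigr => sg _.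
  by rewrite -EFinM /c mulrA.
have intP sg : lebesgue_measure.-integrable D (fun u => (P sg u)%:E * (c sg)%:E)%E.
  by have H := fun mD => integrableZr mD (c sg) (iM sg); apply: H; exact: measurable_itv.
rewrite integral_sum //; last exact: measurable_itv.
rewrite mulr_suml -sumEFin; apply: eq_bigr => sg _.
rewrite integralZr //; last 2 first.
- exact: measurable_itv.
- exact: iM.
rewrite -(fineK (integrable_fin_num _ (iM sg))) //; last exact: measurable_itv.
by rewrite -[LHS]EFinM -mulrA.
Qed.

Lemma angle_cvg0 (u : R) : u / arc_scale n @[n --> \oo] --> (0 : R).
Proof.
rewrite -(mulr0 (u / (p.+1%:R * s))).
rewrite (_ : (fun n => _) = fun n => u / (p.+1%:R * s) * (n%:R `^ (1 / 4))^-1); last first.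
  by apply/funext => n; rewrite /arc_scale invfM mulrA.
apply: cvgM; first exact: cvg_cst.
apply/gtr0_cvgV0; last exact: powR14_cvgy.
by near=> n; apply: powR14_gt0; near: n; exact: nbhs_infty_gt.
Unshelve. all: by end_near. Qed.

(** The constant is that of [site_factor_quartic] divided by the fourth power of
    [(p + 1) s]. *)
Lemma site_factor_pow_cvg (u : R) : site_factor p s (u / arc_scale n) ^+ n @[n --> \oo] -->
  expR (- ((p%:R - 1) * p%:R / (12 * (p%:R + 1) ^+ 2) * u ^+ 4)).
Proof.
wlog u0 : u / 0 < u => [W|].
  have [/W//|u0|<-] := ltgtP 0 u.
    have := W (- u); rewrite oppr_gt0 (_ : (- u) ^+ 4 = u ^+ 4); last by ring.
    move=> /(_ u0); rewrite (_ : (fun n => site_factor p s (- u / arc_scale n) ^+ n) =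
      fun n => site_factor p s (u / arc_scale n) ^+ n) //.
    by apply/funext => n; rewrite mulNr site_factorN.
  rewrite expr0n mulr0 oppr0 expR0 (_ : (fun n => _) = cst 1); first exact: cvg_cst.
  by apply/funext => n; rewrite mul0r site_factor0 expr1n.
have angle : u / arc_scale n @[n --> \oo] --> (0 : R)^'+.
  move=> A /= A0.
  have H : \forall n \near \oo, 0 < u / arc_scale n -> A (u / arc_scale n).
    exact: (angle_cvg0 u A0).
  rewrite /nbhs /=; near=> n; have : 0 < u / arc_scale n -> A (u / arc_scale n) by near: n.
  apply; rewrite divr_gt0 // arc_scale_gt0 //; near: n; exact: nbhs_infty_gt.
have Q := cvg_comp _ _ angle (site_factor_quartic p2 sp).
rewrite (_ : (fun n => _) = fun n => (1 + (site_factor p s (u / arc_scale n) - 1)) ^+ n);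
  last first.
  by apply/funext => n; rewrite subrKC.
apply: exp_pow_limit.
set k := (X in _ --> X); pose a := u / (p.+1%:R * s).
have pn0 : p%:R != 0 :> R by rewrite pnatr_eq0; case: p p2.
have -> : k = - ((p%:R - 1) * (p%:R + 1) ^+ 2 / (12 * p%:R)) * a ^+ 4.
  have s4 : s ^+ 4 = p%:R^-1 ^+ 2.
    have -> : s ^+ 4 = (s ^+ 2) ^+ 2 by ring.
    by congr (_ ^+ 2); apply: (mulIf pn0); rewrite sp mulVf.
  rewrite /a expr_div_n exprMn s4 -natr1 /k; field.
  by rewrite pn0 /= nat1r pnatr_eq0.
apply: (@cvg_trans _ ((fun n => ((site_factor p s (u / arc_scale n) - 1) / (u
  / arc_scale n) ^+ 4) * a ^+ 4) @ \oo)).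
  apply: near_eq_cvg; near=> n.
  have n0 : (0 < n)%N by near: n; exact: nbhs_infty_gt.
  have r0 := powR14_gt0 R n0; rewrite -(powR14_4 R n) /a /arc_scale; field.
  by rewrite nat1r pnatr_eq0 /= (gt_eqF r0) (gt_eqF s0) (gt_eqF u0).
by apply: cvgM; [exact: Q|exact: cvg_cst].
Unshelve. all: by end_near. Qed.

(** The two single-site weights are [1] at angle [0] and have derivatives
    [(p + 1) s] and [- (p + 1) s] there. *)
Lemma tilted_mean_cvg (u : R) :
  n%:R `^ (1 / 4) * ((arc_coord s (u / arc_scale n) ^+ p.+1 - arc_coord (- s) (u
    / arc_scale n) ^+ p.+1)
    / (arc_coord s (u / arc_scale n) ^+ p.+1 + arc_coord (- s) (u / arc_scale n) ^+ p.+1)) @[n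
      --> \oo] --> u.
Proof.
pose N t : R := arc_coord s t ^+ p.+1 - arc_coord (- s) t ^+ p.+1.
have dX (r : R) : is_derive (0:R) 1 (fun u : R => arc_coord r u ^+ p.+1) (p.+1%:R * r).
  rewrite (_ : (fun u => _) = arc_coord r ^+ p.+1); last by apply/funext => v; rewrite exprfctE.
  apply: (is_derive_eq (is_deriveX p.+1 (is_derive_arc_coord r (0:R)))).
  by rewrite /GRing.scale /= arc_coord0 expr1n mulr1 /darc_coord sin0 cos0 oppr0 add0r mulr1.
have dN := is_deriveB (dX s) (dX (- s)).
(* Caratheodory's form of the derivative also covers u = 0, where a quotient
   would be 0 / 0. *)
have /is_derive1_caratheodory[h [hE ch h0]] := dN.
have hE' t : N t = h t * t.
  by have := hE t; rewrite /= !fctE !arc_coord0 !expr1n subr0 subrr subr0.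
have a0 := angle_cvg0 u.
have hc : h (u / arc_scale n) @[n --> \oo] --> (p.+1%:R * s * 2 : R).
  have -> : p.+1%:R * s * 2 = h 0 by rewrite h0; ring.
  by apply: (cvg_comp _ _ a0 ch).
have Sc : site_factor p s (u / arc_scale n) @[n --> \oo] --> (1 : R).
  have H := cvg_comp _ _ a0 ((continuous_site_factor sp : continuous _) (0 : R)).
  by rewrite site_factor0 in H; exact: H.
have uE : u / (p.+1%:R * s) * (p.+1%:R * s * 2) / (2 * 1) = u.
  by field; rewrite nat1r pnatr_eq0 (gt_eqF s0).
have L : u / (p.+1%:R * s) * h (u / arc_scale n) / (2 * site_factor p s (u / arc_scale n))
    @[n --> \oo] --> u / (p.+1%:R * s) * (p.+1%:R * s * 2) / (2 * 1).
  apply: cvgM; first by apply: cvgM; [exact: cvg_cst|exact: hc].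
  apply: cvgV; first by rewrite mulr1.
  by apply: cvgM; [exact: cvg_cst|exact: Sc].
rewrite uE in L; apply: cvg_trans L; apply: near_eq_cvg; near=> n.
have n0 : (0 < n)%N by near: n; exact: nbhs_infty_gt.
have r0 := powR14_gt0 R n0.
have -> : arc_coord s (u / arc_scale n) ^+ p.+1 + arc_coord (- s) (u / arc_scale n) ^+ p.+1
   = 2 * site_factor p s (u / arc_scale n) by rewrite /site_factor; field.
rewrite -/(N _) hE' !mulrA; congr (_ / _).
rewrite /arc_scale; field.
by rewrite nat1r pnatr_eq0 /= (gt_eqF r0) (gt_eqF s0).
Unshelve. all: by end_near. Qed.

End Integrand.

Section IntegrandLimit.
Variables (R : realType) (p : nat) (s : R).
Hypotheses (p2 : (2 <= p)%N) (s0 : 0 < s) (sp : s ^+ 2 * p%:R = 1).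
Variables (g : R -> R) (K : R).
Hypotheses (cg : continuous g) (gK : forall x, `|g x| <= K).

Let site_weight (r : R) (u : R) n := arc_coord r (u / arc_scale p s n) ^+ p.+1.

Lemma site_weight_cvg1 (r u : R) : site_weight r u n @[n --> \oo] --> (1 : R).
Proof.
have H := cvg_comp _ _ (angle_cvg0 p s u) ((@continuous_arc_coord R r : continuous _) (0 : R)).
rewrite arc_coord0 in H; rewrite -[X in _ --> X](expr1n R p.+1).
apply: (@continuous_cvg _ _ _ _ _ (fun n => arc_coord r (u / arc_scale p s n)) (fun x : R
  => x ^+ p.+1)).
  exact: exprn_continuous.
exact: H.
Qed.

Let site_law u n (b : bool) : R := (if b then site_weight s u n else site_weight (- s) u n) /
  (site_weight s u n + site_weight (- s) u n).

(** The law of large numbers behind the limit: the product measure concentrates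
    the rescaled total spin at [u]. *)
Lemma tilted_mean_test_cvg u :
  \sum_(sg : config n) (\prod_(i < n) site_law u n (sg i)) * g (total_spin R sg / n%:R `^ (3 / 4))
  @[n --> \oo] --> g u.
Proof.
apply/cvgrPdist_le => e e0.
have [C C0 gC] := continuous_bounded_quadratic u cg gK (divr_gt0 e0 (ltr0n R 2)).
pose rm n := n%:R `^ (1 / 4) * ((site_weight s u n - site_weight (- s) u n) /
  (site_weight s u n + site_weight (- s) u n)).
pose er n := C * (2 / (n%:R `^ (1 / 4)) ^+ 2 + 2 * (rm n - u) ^+ 2).
have rmc : rm n @[n --> \oo] --> u by exact: tilted_mean_cvg.
have er0 : er n @[n --> \oo] --> (0 : R).
  have E : C * (2 * 0 ^+ 2 + 2 * (u - u) ^+ 2) = 0 :> R by rewrite subrr expr0n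
    /= !mulr0 addr0 mulr0.
  rewrite -[X in _ --> X]E; apply: cvgM; first exact: cvg_cst.
  have sqc (f : nat -> R) (l : R) : f n @[n --> \oo] --> l -> f n ^+ 2 @[n --> \oo] --> l ^+ 2.
    move=> fl; apply: (@continuous_cvg _ _ _ _ _ f (fun x : R => x ^+ 2)) => //.
    exact: exprn_continuous.
  apply: cvgD; apply: cvgM; try exact: cvg_cst.
    under eq_fun do rewrite -exprVn.
    apply: sqc; apply/gtr0_cvgV0; last exact: powR14_cvgy.
    by near=> n; apply: powR14_gt0; near: n; exact: nbhs_infty_gt.
  by apply: sqc; apply: cvgB; [exact: rmc|exact: cvg_cst].
near=> n.
have n0 : (0 < n)%N by near: n; exact: nbhs_infty_gt.
have X0 : 0 < site_weight s u n by near: n; apply: (cvgr_gt _ (site_weight_cvg1 s u));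
  exact: ltr01.
have Y0 : 0 < site_weight (- s) u n by near: n; apply: (cvgr_gt _ (site_weight_cvg1 (- s) u));
  exact: ltr01.
have A0 : 0 < site_weight s u n + site_weight (- s) u n by rewrite addr_gt0.
have law_sum1 : site_law u n true + site_law u n false = 1 by rewrite /site_law -mulrDl divff
  // gt_eqF.
have law_ge0 b : 0 <= site_law u n b by rewrite divr_ge0 ?(ltW A0) //; case: b; rewrite ltW.
have ere : er n <= e / 2.
  by near: n; apply: (cvgr_le _ er0); rewrite divr_gt0.
have P1 : \sum_(sg : config n) \prod_(i < n) site_law u n (sg i) = 1.
  by rewrite (sum_config_prod (fun _ b => site_law u n b)) big1.
have QE : \sum_(sg : config n) (\prod_(i < n) site_law u n (sg i)) * g (total_spin R sg
  / n%:R `^ (3 / 4))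
    - g u = \sum_(sg : config n) (\prod_(i < n) site_law u n (sg i)) *
      (g (total_spin R sg / n%:R `^ (3 / 4)) - g u).
  by under [RHS]eq_bigr do rewrite mulrBr; rewrite sumrB -mulr_suml P1 mul1r.
rewrite distrC QE.
apply: (le_trans (ler_norm_sum _ _ _)).
apply: (@le_trans _ _ (\sum_(sg : config n) (\prod_(i < n) site_law u n (sg i)) *
    (e / 2 + C * (total_spin R sg / n%:R `^ (3 / 4) - u) ^+ 2))).
  apply: ler_sum => sg _; rewrite normrM ger0_norm ?prodr_ge0 //.
  by rewrite ler_wpM2l ?prodr_ge0.
under eq_bigr do rewrite mulrDr [X in _ + X]mulrCA.
rewrite big_split /= -mulr_suml P1 mul1r -mulr_sumr [leRHS](splitr e) lerD2l.
apply: le_trans ere; rewrite /er ler_wpM2l // powR34 /rm.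
have := product_spin_second_moment u (powR14_gt0 R n0) (esym (powR14_4 R n)) law_sum1
  (law_ge0 _) (law_ge0 _).
by rewrite /site_law -mulrBl.
Unshelve. all: by end_near. Qed.

Lemma arc_integrand_cvg u : arc_integrand p s g n u @[n --> \oo] -->
  g u * expR (- ((p%:R - 1) * p%:R / (12 * (p%:R + 1) ^+ 2) * u ^+ 4)).
Proof.
rewrite [X in _ --> X]mulrC.
have H : site_factor p s (u / arc_scale p s n) ^+ n *
    (\sum_(sg : config n) (\prod_(i < n) site_law u n (sg i)) * g (total_spin R sg / n%:R `^ (3
      / 4)))
    @[n --> \oo] --> expR (- ((p%:R - 1) * p%:R / (12 * (p%:R + 1) ^+ 2) * u ^+ 4)) * g u.
  exact: (cvgM (site_factor_pow_cvg p2 s0 sp (u := u)) (@tilted_mean_test_cvg u)).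
apply: cvg_trans H; apply: near_eq_cvg; near=> n.
have n0 : (0 < n)%N by near: n; exact: nbhs_infty_gt.
have A0 : site_weight s u n + site_weight (- s) u n != 0.
  have X0 : 0 < site_weight s u n by near: n; apply: (cvgr_gt _ (site_weight_cvg1 s u));
    exact: ltr01.
  have Y0 : 0 < site_weight (- s) u n by near: n; apply: (cvgr_gt _ (site_weight_cvg1
    (- s) u)); exact: ltr01.
  by rewrite gt_eqF // addr_gt0.
have L0 := arc_scale_gt0 p s0 n0.
have uL : `|u / arc_scale p s n| <= pi / 2.
  near: n; apply: (cvgr_norm_le _ (angle_cvg0 p s u)).
  by rewrite normr0 divr_gt0 ?pi_gt0.
rewrite /arc_integrand indicE mem_set ?mul1r; last first.
  by move: uL; rewrite /= in_itv /= -ler_norml normrM normfV (gtr0_norm L0) ler_pdivrMr // mulrC.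
rewrite [RHS]mulrC /tilted_sum mulr_sumr mulr_sumr; apply: eq_bigr => sg _.
rewrite !mulrA; congr (_ * _).
have -> : \prod_(i < n) (if sg i then site_weight s u n else site_weight (- s) u n) =
  (\prod_(i < n) site_law u n (sg i)) * (site_weight s u n + site_weight (- s) u n) ^+ n.
  rewrite -[X in _ ^+ X]card_ord -prodr_const -big_split /=; apply: eq_bigr => i _.
  by rewrite /site_law divfK.
by rewrite /site_factor expr_div_n [RHS]mulrC [LHS]mulrC mulrA.
Unshelve. all: by end_near. Qed.

End IntegrandLimit.

(** * Probability measures with a density, and the quartic exponential *)

Section Density.
Variables (R : realType) (h : R -> R).
Hypotheses (h0 : forall x, 0 <= h x) (mh : measurable_fun [set: R] h).
Hypothesis h1 : (\int[lebesgue_measure]_x (h x)%:E)%E = 1%E.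
Local Notation mu := (@lebesgue_measure R).

Definition density_measure : set (measurableTypeR R) -> \bar R :=
  fun A => (\int[mu]_(x in A) (h x)%:E)%E.

Lemma integrable_density : mu.-integrable [set: R] (EFin \o h).
Proof.
apply/integrableP; split; first exact/measurable_EFinP.
under eq_integral do rewrite /= ger0_norm //.
by rewrite h1 ltry.
Qed.

Let density0 : density_measure set0 = 0%E.
Proof. by rewrite /density_measure integral_set0. Qed.

Let density_ge0 A : (0 <= density_measure A)%E.
Proof. by apply: integral_ge0 => x _; rewrite lee_fin. Qed.

Let density_sigma_additive : semi_sigma_additive density_measure.
Proof.
move=> /= A mA tA mUA.
rewrite /density_measure integral_bigcup//=; last first.
  by apply: (integrableS _ _ (@subsetT _ _)) => //; exact: integrable_density.
apply: is_cvg_ereal_nneg_natsum_cond => n _ _.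
by apply: integral_ge0 => /= x ?; rewrite lee_fin.
Qed.

#[local] HB.instance Definition _ := isMeasure.Build _ _ _
  density_measure density0 density_ge0 density_sigma_additive.

Let density_setT : density_measure [set: _] = 1%E.
Proof. exact: h1. Qed.

#[local] HB.instance Definition _ :=
  @Measure_isProbability.Build _ _ R density_measure density_setT.

Lemma exists_density_probability : exists P : probability (measurableTypeR R) R,
  forall A, measurable A -> P A = (\int[mu]_(x in A) (h x)%:E)%E.
Proof. by exists density_measure. Qed.

(** By uniqueness of the Radon-Nikodym derivative. *)
Lemma integral_density_probability (P : probability (measurableTypeR R) R) (f : R -> R) (K : R) :
  (forall A, measurable A -> P A = (\int[mu]_(x in A) (h x)%:E)%E) ->
  measurable_fun [set: R] f -> (forall x, `|f x| <= K) ->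
  (\int[P]_x (f x)%:E = \int[mu]_x (f x * h x)%:E)%E.
Proof.
move=> PE mf fK.
have dom : P `<< mu.
  apply/null_content_dominatesP => A mA A0; rewrite PE //.
  apply: null_set_integral => //; apply/measurable_funTS/measurable_EFinP; exact: mh.
rewrite -(Radon_Nikodym_change_of_variables dom) //=; last first.
  apply/integrableP; split; first exact/measurable_EFinP.
  apply: (@le_lt_trans _ _ (\int[P]_x cst K%:E x)%E).
    apply: ge0_le_integral => //=.
    - by apply/measurable_EFinP/measurableT_comp => //; exact: mf.
    - by move=> x _; rewrite lee_fin.
  by rewrite integral_cst //= probability_setT mule1 ltry.
apply: ae_eq_integral => //.
- by apply: emeasurable_funM => //; exact/measurable_EFinP.
- apply/measurable_EFinP; exact: measurable_funM.
- rewrite (_ : (fun x => (f x * h x)%:E) = fun x => ((f x)%:E * (h x)%:E)%E) //.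
  apply: ae_eqe_mul2l => /=.
  rewrite Radon_NikodymE //=; case: cid => /= k [k1 k2 k3].
  apply: integral_ae_eq => //=.
  + exact/measurable_EFinP.
  + by move=> A _ mA; rewrite -k3 // -PE.
Qed.

End Density.

Section QuarticLaw.
Variables (R : realType) (k : R).
Hypothesis k0 : 0 < k.
Local Notation mu := (@lebesgue_measure R).

Lemma continuous_quartic : continuous (fun x : R => expR (- (k * x ^+ 4))).
Proof.
move=> x; apply: (@continuous_comp _ _ _ (fun x : R => - (k * x ^+ 4)) expR);
  last exact: continuous_expR.
by apply: cvgN; apply: cvgM; [exact: cvg_cst|exact: exprn_continuous].
Qed.

Lemma measurable_quartic : measurable_fun [set: R] (fun x : R => expR (- (k * x ^+ 4))).
Proof. by apply: continuous_measurable_fun; exact: continuous_quartic. Qed.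

(** Comparison with a Gaussian density. *)
Lemma integrable_quartic : mu.-integrable [set: R] (fun x => (expR (- (k * x ^+ 4)))%:E).
Proof.
(* The constant completes the square: k x^4 - x^2 / 2 + 1 / (16 k) =
   k (x^2 - 1 / (4 k))^2. *)
pose C := expR (1 / (16 * k)) / normal_peak (1 : R).
have pk : 0 < normal_peak (1 : R) by apply: normal_peak_gt0; exact: oner_neq0.
have iC : mu.-integrable [set: R] (fun x => (C * normal_pdf 0 1 x)%:E).
  by have H := fun mT => integrableZl mT C (integrable_normal_pdf (0 : R) 1);
    exact: (H measurableT).
apply: (le_integrable _ _ _ iC) => //.
- by apply/measurable_EFinP; exact: measurable_quartic.
- move=> x _; rewrite lee_fin !ger0_norm ?expR_ge0 ?mulr_ge0 ?normal_pdf_ge0 ?divr_ge0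
    ?expR_ge0 ?invr_ge0 ?(ltW pk) //.
  have -> : normal_pdf 0 1 x = normal_peak 1 * normal_fun 0 1 x by rewrite normal_pdfE ?oner_neq0.
  rewrite [leRHS]mulrA /C divfK ?gt_eqF // /normal_fun -expRD ler_expR.
  rewrite subr0 expr1n -subr_ge0.
  rewrite (_ : _ - _ = k * (x ^+ 2 - 1 / (4 * k)) ^+ 2); last by field; rewrite gt_eqF.
  by rewrite mulr_ge0 ?sqr_ge0 // ltW.
Qed.

Lemma integral_quartic_gt0 : exists2 z : R, 0 < z &
  (\int[mu]_x (expR (- (k * x ^+ 4)))%:E)%E = z%:E.
Proof.
have ifin := integrable_fin_num measurableT integrable_quartic.
exists (fine (\int[mu]_x (expR (- (k * x ^+ 4)))%:E)%E); last by rewrite fineK.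
rewrite -lte_fin fineK //.
apply: (@lt_le_trans _ _ (\int[mu]_(x in `[0%R, 1%R]) (expR (- k))%:E)%E).
  rewrite integral_cst //= lebesgue_measure_itv /= lte_fin ltr01 oppr0 adde0 mule1.
  by rewrite lte_fin expR_gt0.
apply: (@le_trans _ _ (\int[mu]_(x in `[0%R, 1%R]) (expR (- (k * x ^+ 4)))%:E)%E).
  apply: ge0_le_integral => //=.
  - by apply/measurable_funTS/measurable_EFinP; exact: measurable_quartic.
  - move=> x; rewrite in_itv /= => /andP[x0 x1]; rewrite lee_fin ler_expR lerN2.
    by rewrite ler_piMr ?(ltW k0) // exprn_ile1.
apply: ge0_subset_integral => //=.
by apply/measurable_EFinP; exact: measurable_quartic.
Qed.

End QuarticLaw.

(** * The limit law *)

Section Limit.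
Variables (R : realType) (p : nat) (s : R).
Hypotheses (p2 : (2 <= p)%N) (s0 : 0 < s) (sp : s ^+ 2 * p%:R = 1).
Local Notation mu := (@lebesgue_measure R).

Definition quartic_rate : R := (p%:R - 1) * p%:R / (12 * (p%:R + 1) ^+ 2).

Lemma quartic_rate_gt0 : 0 < quartic_rate.
Proof.
have : 2 <= p%:R :> R by rewrite ler_nat.
move=> P2; rewrite divr_gt0 ?mulr_gt0 ?exprn_gt0 //; lra.
Qed.

(** Dominated convergence, the dominating function being that of
    [arc_integrand_le]. *)
Lemma arc_integral_cvg (g : R -> R) (K : R) : continuous g -> (forall x, `|g x| <= K) ->
  mu.-integrable [set: R] (fun u => (g u * expR (- (quartic_rate * u ^+ 4)))%:E) /\
  (\int[mu]_u (arc_integrand p s g n u)%:E)%E @[n --> \oo] -->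
  (\int[mu]_u (g u * expR (- (quartic_rate * u ^+ 4)))%:E)%E.
Proof.
move=> cg gK; have [c c0 bd] := arc_integrand_le p2 s0 sp gK.
have iD : mu.-integrable [set: R] (fun u => (K * expR (- (c * u ^+ 4)))%:E).
  by have H := fun mT => integrableZl mT K (integrable_quartic c0); exact: (H measurableT).
have [] := @dominated_convergence _ _ _ mu setT measurableT
  (fun n u => (arc_integrand p s g n u)%:E)
  (fun u => (g u * expR (- (quartic_rate * u ^+ 4)))%:E)
  (fun u => (K * expR (- (c * u ^+ 4)))%:E) _ _ _ iD.
- by move=> n; apply/measurable_EFinP; exact: measurable_arc_integrand.
- apply/measurable_EFinP; apply: measurable_funM; last exact: measurable_quartic.
  exact: continuous_measurable_fun.
- apply: aeW => u _; apply: cvg_EFin; first by near=> n.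
  exact: (arc_integrand_cvg p2 s0 sp cg gK).
- by apply: aeW => u n _; rewrite lee_fin bd.
by move=> ig _ lim; split.
Unshelve. all: by end_near. Qed.

Definition arc_total (g : R -> R) (n : nat) : R :=
  \sum_(sg : config n)
    (\int[mu]_(u in `[(- (arc_scale p s n * (pi / 2))), (arc_scale p s n * (pi / 2))])
     \prod_(i < n) (if sg i then arc_coord s (u / arc_scale p s n) ^+ p.+1
                    else arc_coord (- s) (u / arc_scale p s n) ^+ p.+1))%R *
    g (total_spin R sg / n%:R `^ (3 / 4)).

Lemma arc_total_cvg (g : R -> R) (K z : R) : continuous g -> (forall x, `|g x| <= K) ->
  (\int[mu]_u (g u * expR (- (quartic_rate * u ^+ 4)))%:E)%E = z%:E ->
  arc_total g n / 2 ^+ n @[n --> \oo] --> z.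
Proof.
move=> cg gK zE; have [_] := arc_integral_cvg cg gK; rewrite zE.
by under eq_fun do rewrite integral_arc_integrand; move/fine_cvg.
Qed.

End Limit.

Theorem theorem1p3 (R : realType) (d : nat) (hd : (3 <= d)%N) :
  exists (dS : measure_display) (S : measurableType dS) (P : probability S R)
    (X : {RV P >-> R}),
    has_density_proportional_to X
      (fun x : R => expR (- ((d%:R - 1) * (d%:R - 2) * x ^+ 4)
                          / (12 * d%:R ^+ 2))) /\
    cvg_in_distribution (within [set n : nat | ~~ odd (d * n)] \oo)
      (fun (n : nat) (s : config n) =>
         annealed d (ln (d%:R / (d%:R - 2)) / 2) 0 s)
      (fun (n : nat) (s : config n) => total_spin R s / n%:R `^ (3 / 4))
      X.
Proof.
case: d hd => [//|p] p2; rewrite ltnS in p2.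
have pgt0 : 0 < p%:R :> R by rewrite ltr0n ltnW.
pose s : R := (Num.sqrt p%:R)^-1.
have s0 : 0 < s by rewrite invr_gt0 sqrtr_gt0.
have sp : s ^+ 2 * p%:R = 1 by rewrite exprVn sqr_sqrtr ?ltW // mulVf // gt_eqF.
set k : R := quartic_rate R p; have k0 : 0 < k by exact: quartic_rate_gt0.
have [z z0 zE] := integral_quartic_gt0 k0.
pose h (x : R) := z^-1 * expR (- (k * x ^+ 4)).
have h0 x : 0 <= h x by rewrite mulr_ge0 ?expR_ge0 // invr_ge0 ltW.
have mh : measurable_fun [set: R] h.
  by apply: measurable_funM => //; exact: measurable_quartic.
have h1 : (\int[lebesgue_measure]_x (h x)%:E)%E = 1%E.
  rewrite /h; under eq_integral do rewrite EFinM.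
  by rewrite integralZl ?zE -?EFinM ?mulVf ?gt_eqF //; exact: integrable_quartic.
have [P PE] := exists_density_probability h0 mh h1.
have fE x : expR (- ((p.+1%:R - 1) * (p.+1%:R - 2) * x ^+ 4) / (12 * p.+1%:R ^+ 2)) =
    expR (- (k * x ^+ 4)) :> R.
  by congr expR; rewrite /k /quartic_rate -natr1; field; rewrite natr1 pnatr_eq0.
pose idR : measurableTypeR R -> R := idfun.
pose idM := @isMeasurableFun.Build _ _ _ _ idR (@measurable_id _ _ setT).
pose X : {mfun measurableTypeR R >-> R} := HB.pack idR idM.
exists _, (measurableTypeR R), P, (X : {RV P >-> R}); split.
  exists z^-1; first by rewrite invr_gt0.
  move=> A mA; rewrite /distribution /pushforward PE //.
  by apply: eq_integral => x _; rewrite fE.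
move=> g cg [K gK].
have c1 x : `|(fun _ : R => 1 : R) x| <= 1 by rewrite normr1.
have cc1 : continuous (fun _ : R => 1 : R) by move=> x; exact: cvg_cst.
have z1E : (\int[lebesgue_measure]_u (1 * expR (- (k * u ^+ 4)))%:E)%E = z%:E.
  by under eq_integral do rewrite mul1r.
have [ig _] := arc_integral_cvg p2 s0 sp cg gK.
have /fineK/esym := integrable_fin_num measurableT ig; set zg := fine _ => zgE.
have L1 := arc_total_cvg p2 s0 sp cc1 c1 z1E.
have Lg := arc_total_cvg p2 s0 sp cg gK zgE.
have Lq : arc_total p s g n / 2 ^+ n / (arc_total p s (fun _ => 1) n / 2 ^+ n) @[n --> \oo]
  --> zg / z.
  by apply: cvgM; [exact: Lg|apply: cvgV; [rewrite gt_eqF|exact: L1]].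
have -> : 'E_P[g \o X]%E = (zg / z)%:E.
  rewrite unlock (integral_density_probability mh PE _ gK); last first.
    exact: continuous_measurable_fun.
  rewrite (_ : (fun x => _) = (fun x => (z^-1)%:E * (g x * expR (- (k * x ^+ 4)))%:E)%E);
    last first.
    by apply/funext => x; rewrite -EFinM /h mulrCA.
  by rewrite integralZl // zgE -EFinM mulrC.
apply: cvg_EFin; first by near=> n.
have Lq' := @cvg_within_filter _ _ _ \oo _ _ [set n : nat | ~~ odd (p.+1 * n)] Lq.
suff EQ : \forall n \near within [set n : nat | ~~ odd (p.+1 * n)] \oo,
    arc_total p s g n / 2 ^+ n / (arc_total p s (fun _ => 1) n / 2 ^+ n) =
    \sum_(t : config n) annealed p.+1 (ln (p.+1%:R / (p.+1%:R - 2)) / 2) 0 t *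
          g (total_spin R t / n%:R `^ (3 / 4)).
  have FF : Filter (within [set n : nat | ~~ odd (p.+1 * n)] \oo) by apply: within_filter.
  exact: (cvg_trans (@near_eq_cvg _ _ _ FF _ _ EQ) (Lq' _)).
near=> n.
have n0 : (0 < n)%N by near: n; apply: cvg_within; exact: nbhs_infty_gt.
have ev : ~~ odd (p.+1 * n) by near: n; exact: withinT.
have L0 := arc_scale_gt0 p s0 n0.
(* The critical temperature is where exp (- 2 beta) = (1 - s ^ 2) / (1 + s ^ 2). *)
have bs : expR (- (ln (p.+1%:R / (p.+1%:R - 2)) / 2)) * (1 + s ^+ 2) =
    expR (ln (p.+1%:R / (p.+1%:R - 2)) / 2) * (1 - s ^+ 2) :> R.
  have d0 : 0 < p.+1%:R :> R by [].
  have d2 : 0 < p.+1%:R - 2 :> R by rewrite subr_gt0 ltr_nat ltnS.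
  set b := ln _ / 2.
  have E2 : expR b ^+ 2 = p.+1%:R / (p.+1%:R - 2).
    by rewrite -expRM_natl /b mulrCA divff // mulr1 lnK // posrE divr_gt0.
  have sE : s ^+ 2 = p%:R^-1 by apply: (mulIf (lt0r_neq0 pgt0)); rewrite sp mulVf // gt_eqF.
  have eb : expR b != 0 by rewrite gt_eqF ?expR_gt0.
  rewrite expRN; apply: (mulfI eb); rewrite !mulrA divff // mul1r -expr2 E2 sE.
  by field; rewrite gt_eqF //= nat1r gt_eqF.
have aE sg := annealed_arc sg L0 ev bs.
rewrite invf_div mulrA divfK ?gt_eqF ?exprn_gt0 //.
under [RHS]eq_bigr do rewrite aE /= mulrAC.
rewrite -mulr_suml /arc_total; congr (_ / _).
by apply: eq_bigr => sg _; rewrite mulr1.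
Unshelve. all: by end_near. Qed.
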